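(* Let $\mathbb T=\mathbb R/2\pi\mathbb Z$ and consider the following equations for $(t,x)\in\mathbb R\times\mathbb T$. (1) The defocusing nonlinear Schr\''odinger equation $-iu_t+u_{xx}=|u|^2u$ ($u$ complex-valued) is ill-posed in $H^s(\mathbb T)$ for all $s<0$. (2) The modified real Korteweg-de Vries equation $u_t+u_{xxx}=6u^2u_x$ ($u$ real-valued) is ill-posed in $H^s(\mathbb T)$ for all $s\in(-1,1/2)$. (3) The real Korteweg-de Vries equation $u_t+u_{xxx}=6uu_x$ ($u$ real-valued) is ill-posed in $H^s(\mathbb T)$ for all $s\in(-2,-1/2)$.
   Context: For each of these equations, smooth initial data $u_0\in C^\infty(\mathbb T)$ (real-valued in cases (2), (3)) give rise to unique global smooth solutions $u$ with $u(0,\cdot)=u_0$; let $S$ denote the solution map $u_0\mapsto u$ on smooth data. The equation is locally well-posed in $H^s(\mathbb T)$ if for every radius $R>0$ there exists a time $T=T(R)>0$ such that the solution map $S$ (restricted to smooth data) can be uniformly continuously and uniquely extended to a map from the ball $\{u_0\in H^s(\mathbb T):\|u_0\|_{H^s}<R\}$ to the space $C^0_t((-T,T);H^s(\mathbb T))$ with norm $\sup_{t\in(-T,T)}\|u(t)\|_{H^s}$. The equation is ill-posed in $H^s(\mathbb T)$ if it is not locally well-posed in this sense. *)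

(* Defs.v *)
From Stdlib Require Import Reals ZArith.
From Coquelicot Require Import Coquelicot.
Open Scope R_scope.

(* Functions on T = R/2piZ are 2pi-periodic functions on R. *)
Definition smooth_on_torus (f : R -> C) : Prop :=
  (forall x, f (x + 2 * PI) = f x) /\
  (forall n x, ex_derive_n (fun y => Re (f y)) n x) /\
  (forall n x, ex_derive_n (fun y => Im (f y)) n x).

Definition smooth_on_spacetime (u : R -> R -> C) : Prop :=
  (forall t x, u t (x + 2 * PI) = u t x) /\
  (forall n t x, ex_diff_n (fun t' x' => Re (u t' x')) n t x) /\
  (forall n t x, ex_diff_n (fun t' x' => Im (u t' x')) n t x).

Definition dt (u : R -> R -> C) (t x : R) : C :=
  (Derive (fun t' => Re (u t' x)) t, Derive (fun t' => Im (u t' x)) t).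

Definition dx (n : nat) (u : R -> R -> C) (t x : R) : C :=
  (Derive_n (fun x' => Re (u t x')) n x, Derive_n (fun x' => Im (u t x')) n x).

Record equation := Equation {
  real_valued : Prop;
  pde : (R -> R -> C) -> R -> R -> Prop
}.

Definition NLS : equation := {|
  real_valued := False;
  pde := fun u t x =>
    (- Ci * dt u t x + dx 2 u t x = RtoC (Cmod (u t x) ^ 2)%R * u t x)%C
|}.

Definition mKdV : equation := {|
  real_valued := True;
  pde := fun u t x =>
    (dt u t x + dx 3 u t x = RtoC 6 * (u t x * u t x) * dx 1 u t x)%C
|}.

Definition KdV : equation := {|
  real_valued := True;
  pde := fun u t x =>
    (dt u t x + dx 3 u t x = RtoC 6 * u t x * dx 1 u t x)%C
|}.

(* Graph of the solution map S: [solution_map E u0 u] says that u is the global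
   smooth solution of E with smooth initial datum u0.  Smooth data launch
   unique global smooth solutions for all three equations, so this relation is
   the graph of a function on smooth (real-valued, if required) data. *)
Definition solution_map (E : equation) (u0 : R -> C) (u : R -> R -> C) : Prop :=
  smooth_on_torus u0 /\
  smooth_on_spacetime u /\
  (real_valued E -> forall t x, Im (u t x) = 0) /\
  (forall t x, pde E u t x) /\
  (forall x, u 0 x = u0 x).

(* hat f(k) = (1/2pi) int_0^{2pi} f(x) e^{-ikx} dx *)
Definition fourier (f : R -> C) (k : Z) : C :=
  (RtoC (/ (2 * PI)) *
   RInt (V := C_R_CompleteNormedModule)
     (fun x => (f x * (cos (IZR k * x), - sin (IZR k * x))%R)%C) 0 (2 * PI))%C.

(* A periodic distribution is represented by its Fourier coefficients
   a : Z -> C; it is real-valued iff a(-k) is the conjugate of a(k).  H^s(T) is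
   given by sum_k <k>^{2s} |a(k)|^2 < oo with <k>^2 = 1 + k^2, and the sum over
   Z is split into k >= 0 and k < 0. *)
Definition Hs_term (s : R) (a : Z -> C) (k : Z) : R :=
  Rpower (1 + IZR k ^ 2) s * Cmod (a k) ^ 2.

Definition in_Hs (s : R) (a : Z -> C) : Prop :=
  ex_series (fun n => Hs_term s a (Z.of_nat n)) /\
  ex_series (fun n => Hs_term s a (- Z.of_nat (S n))%Z).

(* Meaningful only under [in_Hs s a]. *)
Definition Hs_norm (s : R) (a : Z -> C) : R :=
  sqrt (Series (fun n => Hs_term s a (Z.of_nat n)) +
        Series (fun n => Hs_term s a (- Z.of_nat (S n))%Z)).

Definition Csub (a b : Z -> C) (k : Z) : C := (a k - b k)%C.

(* For real-valued equations the phase space is the space of real-valued H^s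
   distributions, the closure of the smooth real-valued data. *)
Definition phase_space (E : equation) (s : R) (a : Z -> C) : Prop :=
  in_Hs s a /\ (real_valued E -> forall k, a (- k)%Z = Cconj (a k)).

Definition Hs_ball (E : equation) (s rho : R) (a : Z -> C) : Prop :=
  phase_space E s a /\ Hs_norm s a < rho.

Definition sup_Hs_norm (s T : R) (v : R -> Z -> C) : Rbar :=
  Lub_Rbar (fun r => exists t, - T < t < T /\ r = Hs_norm s (v t)).

(* v restricted to (-T,T) is an element of C^0_t((-T,T); H^s), with finite sup
   norm. *)
Definition in_CtHs (E : equation) (s T : R) (v : R -> Z -> C) : Prop :=
  (forall t, - T < t < T -> phase_space E s (v t)) /\
  (forall t, - T < t < T -> forall eps, 0 < eps ->
     exists delta, 0 < delta /\
       forall t', - T < t' < T -> Rabs (t' - t) < delta ->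
         Hs_norm s (Csub (v t') (v t)) < eps) /\
  is_finite (sup_Hs_norm s T v).

Definition uniformly_continuous_flow
    (E : equation) (s rho T : R) (Phi : (Z -> C) -> R -> Z -> C) : Prop :=
  forall eps, 0 < eps -> exists delta, 0 < delta /\
    forall a b, Hs_ball E s rho a -> Hs_ball E s rho b ->
      Hs_norm s (Csub a b) < delta ->
      Rbar_lt (sup_Hs_norm s T (fun t => Csub (Phi a t) (Phi b t))) eps.

Definition extends_solution_map
    (E : equation) (s rho T : R) (Phi : (Z -> C) -> R -> Z -> C) : Prop :=
  forall u0 u, solution_map E u0 u -> Hs_ball E s rho (fourier u0) ->
    forall t, - T < t < T -> forall k, Phi (fourier u0) t k = fourier (u t) k.

Definition uniformly_continuous_extension
    (E : equation) (s rho T : R) (Phi : (Z -> C) -> R -> Z -> C) : Prop :=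
  (forall a, Hs_ball E s rho a -> in_CtHs E s T (Phi a)) /\
  uniformly_continuous_flow E s rho T Phi /\
  extends_solution_map E s rho T Phi.

(* Phi is constrained only on the ball and on (-T,T), so uniqueness is required
   only there. *)
Definition locally_well_posed (E : equation) (s : R) : Prop :=
  forall rho, 0 < rho -> exists T, 0 < T /\
    exists Phi, uniformly_continuous_extension E s rho T Phi /\
      forall Psi, uniformly_continuous_extension E s rho T Psi ->
        forall a, Hs_ball E s rho a ->
          forall t, - T < t < T -> forall k, Psi a t k = Phi a t k.

Definition ill_posed (E : equation) (s : R) : Prop := ~ locally_well_posed E s.

(* Main.v *)
Require Import Defs.
From Stdlib Require Import Reals ZArith Lra Lia FunctionalExtensionality.
From Coquelicot Require Import Coquelicot.
Open Scope R_scope.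

(** Each equation has explicit travelling waves [f (x - c t)] whose profile
    oscillates at a large frequency N and whose velocity depends on the profile:
    - NLS: plane waves of amplitude A, with [c = - (N^2 + A^2) / N];
    - mKdV: multiples of the Jacobi function sn of modulus k, whose amplitude is
      about N k and whose velocity is [- (2 K / PI)^2 N^2 (1 + k^2)];
    - KdV: multiples of sn^2 plus a constant; by Galilean invariance, adding [mu]
      to the profile changes the velocity by [- 6 mu].
    Take two profiles of size about 1 in H^s that are close in H^s.  Their
    [N]-th Fourier coefficients acquire the relative phase [N (c - c') t], which
    reaches [PI] after an arbitrarily short time as N grows, and then the
    solutions are far apart in H^s.  The smallness of the modulus, needed for the
    profile to be nearly sinusoidal, gives the lower bounds [-1] and [-2] on [s]. *)

(** * Travelling waves *)

Definition smooth (p : R -> R) : Prop := forall n x, ex_derive_n p n x.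

Lemma smooth_Derive_n (p : R -> R) (n : nat) (x : R) :
  smooth p -> is_derive (Derive_n p n) x (Derive_n p (S n) x).
Proof. intros Hp. exact (Derive_correct _ _ (Hp (S n) x)). Qed.

Lemma smooth_continuous (p : R -> R) (x : R) : smooth p -> continuous p x.
Proof. intros Hp. exact (ex_derive_continuous p x (Hp 1%nat x)). Qed.

Lemma smooth_const (c : R) : smooth (fun _ => c).
Proof. intros n x. apply ex_derive_n_const. Qed.

Lemma smooth_minus (p q : R -> R) :
  smooth p -> smooth q -> smooth (fun x => p x - q x).
Proof.
intros Hp Hq n x.
apply ex_derive_n_minus; apply filter_forall; intros y k _; [apply Hp | apply Hq].
Qed.

Lemma smooth_translate (p : R -> R) (h : R) :
  smooth p -> smooth (fun x => p (x + h)).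
Proof. intros Hp n x. apply ex_derive_n_comp_trans, Hp. Qed.

Lemma smooth_dilate (p : R -> R) (a : R) : smooth p -> smooth (fun x => p (a * x)).
Proof. intros Hp n x. apply ex_derive_n_comp_scal, filter_forall. intros y k _. apply Hp. Qed.

Lemma is_derive_linear_phase (q : R -> R) (c a b z q' : R) :
  is_derive q (a * z + b) q' ->
  is_derive (fun y => c * q (a * y + b)) z (c * a * q').
Proof.
intros H. unfold is_derive.
replace (c * a * q') with (scal c (scal a q')) by (unfold scal; simpl; unfold mult; simpl; ring).
apply (is_derive_scal (fun y => q (a * y + b))).
apply (is_derive_comp q (fun y => a * y + b) z q' a); [exact H | auto_derive; auto; ring].
Qed.

Lemma ex_diff_n_linear_phase (p : R -> R) (n m : nat) (c a b t x : R) :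
  smooth p -> ex_diff_n (fun t' x' => c * Derive_n p m (a * t' + b * x')) n t x.
Proof.
intros Hp. revert m c.
assert (Hc : forall m c, continuity_2d_pt (fun t' x' => c * Derive_n p m (a * t' + b * x')) t x).
{ intros m c. apply continuity_2d_pt_mult; [apply continuity_2d_pt_const|].
  apply (continuity_1d_2d_pt_comp (Derive_n p m) (fun t' x' => a * t' + b * x')).
  - apply continuity_pt_filterlim.
    apply (ex_derive_continuous (Derive_n p m) _ (Hp (S m) _)).
  - apply continuity_2d_pt_plus; apply continuity_2d_pt_mult;
      auto using continuity_2d_pt_const, continuity_2d_pt_id1, continuity_2d_pt_id2. }
induction n as [|n IH]; intros m c; split; [apply Hc | exact I | apply Hc |].
assert (Ht : forall t' x', is_derive (fun z => c * Derive_n p m (a * z + b * x')) t'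
    (c * a * Derive_n p (S m) (a * t' + b * x'))).
{ intros t' x'. apply is_derive_linear_phase, smooth_Derive_n, Hp. }
assert (Hx : forall t' x', is_derive (fun z => c * Derive_n p m (a * t' + b * z)) x'
    (c * b * Derive_n p (S m) (a * t' + b * x'))).
{ intros t' x'.
  apply (is_derive_ext (fun z => c * Derive_n p m (b * z + a * t'))).
  - intros z. now rewrite (Rplus_comm (b * z)).
  - rewrite (Rplus_comm (a * t')). apply is_derive_linear_phase, smooth_Derive_n, Hp. }
repeat split.
- eexists; apply Ht.
- eexists; apply Hx.
- eapply ex_diff_n_ext_loc, (IH (S m) (c * a)).
  apply locally_2d_forall. intros u v. symmetry. apply is_derive_unique, Ht.
- eapply ex_diff_n_ext_loc, (IH (S m) (c * b)).
  apply locally_2d_forall. intros u v. symmetry. apply is_derive_unique, Hx.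
Qed.

Definition wave (c : R) (f : R -> C) (t x : R) : C := f (x - c * t).

Definition smooth_profile (f : R -> C) : Prop :=
  (forall x, f (x + 2 * PI) = f x) /\
  smooth (fun x => Re (f x)) /\ smooth (fun x => Im (f x)).

Lemma ex_diff_n_wave (p : R -> R) (c : R) (n : nat) (t x : R) :
  smooth p -> ex_diff_n (fun t' x' => p (x' - c * t')) n t x.
Proof.
intros Hp. eapply ex_diff_n_ext_loc, (ex_diff_n_linear_phase p n 0 1 (- c) 1 t x Hp).
apply locally_2d_forall. intros u v. simpl. rewrite !Rmult_1_l. now replace (v - c * u) with (- c * u + v) by ring.
Qed.

Lemma smooth_on_spacetime_wave (c : R) (f : R -> C) :
  smooth_profile f -> smooth_on_spacetime (wave c f).
Proof.
intros (Hper & HRe & HIm). split; [|split].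
- intros t x. unfold wave. replace (x + 2 * PI - c * t) with (x - c * t + 2 * PI) by ring. apply Hper.
- intros n t x. apply (ex_diff_n_wave (fun y => Re (f y))), HRe.
- intros n t x. apply (ex_diff_n_wave (fun y => Im (f y))), HIm.
Qed.

Lemma Derive_wave (p : R -> R) (c t x : R) :
  smooth p -> Derive (fun t' => p (x - c * t')) t = - c * Derive p (x - c * t).
Proof.
intros Hp. apply is_derive_unique.
assert (H := smooth_Derive_n p 0 (x - c * t) Hp). change (is_derive p (x - c * t) (Derive p (x - c * t))) in H.
auto_derive; [eexists; exact H|]. change (Derive (fun x0 => p x0) (x + - (c * t))) with (Derive p (x - c * t)). ring.
Qed.

Lemma Derive_n_wave (p : R -> R) (c t x : R) (n : nat) :
  Derive_n (fun x' => p (x' - c * t)) n x = Derive_n p n (x - c * t).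
Proof. apply (Derive_n_comp_trans p n x (- (c * t))). Qed.

Lemma dt_wave (c : R) (f : R -> C) (t x : R) :
  smooth_profile f ->
  dt (wave c f) t x =
  (- c * Derive (fun y => Re (f y)) (x - c * t), - c * Derive (fun y => Im (f y)) (x - c * t)).
Proof.
intros (_ & HRe & HIm). unfold dt, wave. f_equal.
- exact (Derive_wave (fun y => Re (f y)) c t x HRe).
- exact (Derive_wave (fun y => Im (f y)) c t x HIm).
Qed.

Lemma dx_wave (n : nat) (c : R) (f : R -> C) (t x : R) :
  dx n (wave c f) t x =
  (Derive_n (fun y => Re (f y)) n (x - c * t), Derive_n (fun y => Im (f y)) n (x - c * t)).
Proof.
unfold dx, wave. f_equal.
- exact (Derive_n_wave (fun y => Re (f y)) c t x n).
- exact (Derive_n_wave (fun y => Im (f y)) c t x n).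
Qed.

Lemma solution_map_wave (E : equation) (c : R) (f : R -> C) :
  smooth_profile f -> (real_valued E -> forall x, Im (f x) = 0) ->
  (forall t x, pde E (wave c f) t x) ->
  solution_map E f (wave c f).
Proof.
intros Hf HIm Hpde. split; [|split; [|split; [|split]]].
- exact Hf.
- now apply smooth_on_spacetime_wave.
- intros HE t x. now apply HIm.
- exact Hpde.
- intros x. unfold wave. f_equal. ring.
Qed.

Lemma NLS_wave (c : R) (f : R -> C) :
  smooth_profile f ->
  (forall x, Derive_n (fun y => Re (f y)) 2 x - c * Derive (fun y => Im (f y)) x =
             ((Re (f x)) ^ 2 + (Im (f x)) ^ 2) * Re (f x)) ->
  (forall x, Derive_n (fun y => Im (f y)) 2 x + c * Derive (fun y => Re (f y)) x =
             ((Re (f x)) ^ 2 + (Im (f x)) ^ 2) * Im (f x)) ->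
  solution_map NLS f (wave c f).
Proof.
intros Hf HRe HIm. apply solution_map_wave; [exact Hf | contradiction |].
intros t x. unfold pde, NLS. rewrite dt_wave, dx_wave by exact Hf.
unfold wave. set (y := x - c * t).
assert (Hmod : (Cmod (f y) ^ 2 = (Re (f y)) ^ 2 + (Im (f y)) ^ 2)%R).
{ unfold Cmod. rewrite pow2_sqrt; [reflexivity|]. apply Rplus_le_le_0_compat; apply pow2_ge_0. }
rewrite Hmod. apply injective_projections; simpl.
- transitivity (((Re (f y)) ^ 2 + (Im (f y)) ^ 2) * Re (f y)); [rewrite <- HRe | unfold Re, Im]; simpl; ring.
- transitivity (((Re (f y)) ^ 2 + (Im (f y)) ^ 2) * Im (f y)); [rewrite <- HIm | unfold Re, Im]; simpl; ring.
Qed.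

Definition real_profile (p : R -> R) (x : R) : C := RtoC (p x).

Lemma smooth_real_profile (p : R -> R) :
  smooth p -> (forall x, p (x + 2 * PI) = p x) -> smooth_profile (real_profile p).
Proof.
intros Hp Hper. split; [|split].
- intros x. unfold real_profile. now rewrite Hper.
- exact Hp.
- exact (smooth_const 0).
Qed.

Lemma mKdV_wave (c : R) (p : R -> R) :
  smooth p -> (forall x, p (x + 2 * PI) = p x) ->
  (forall x, - c * Derive p x + Derive_n p 3 x = 6 * (p x) ^ 2 * Derive p x) ->
  solution_map mKdV (real_profile p) (wave c (real_profile p)).
Proof.
intros Hp Hper Hode. apply solution_map_wave; [now apply smooth_real_profile | reflexivity |].
intros t x. unfold pde, mKdV. rewrite dt_wave, !dx_wave by now apply smooth_real_profile.
unfold wave, real_profile, Re, Im, RtoC. simpl fst. simpl snd.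
set (y := x - c * t).
rewrite Derive_const, !Derive_n_const. apply injective_projections; cbn -[Derive_n].
- change (fun x0 => p x0) with p. change (Derive_n p 1 y) with (Derive p y).
  transitivity (6 * (p y) ^ 2 * Derive p y); [rewrite <- Hode |]; ring.
- ring.
Qed.

Lemma KdV_wave (c : R) (p : R -> R) :
  smooth p -> (forall x, p (x + 2 * PI) = p x) ->
  (forall x, - c * Derive p x + Derive_n p 3 x = 6 * p x * Derive p x) ->
  solution_map KdV (real_profile p) (wave c (real_profile p)).
Proof.
intros Hp Hper Hode. apply solution_map_wave; [now apply smooth_real_profile | reflexivity |].
intros t x. unfold pde, KdV. rewrite dt_wave, !dx_wave by now apply smooth_real_profile.
unfold wave, real_profile, Re, Im, RtoC. simpl fst. simpl snd.
set (y := x - c * t).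
rewrite Derive_const, !Derive_n_const. apply injective_projections; cbn -[Derive_n].
- change (fun x0 => p x0) with p. change (Derive_n p 1 y) with (Derive p y).
  transitivity (6 * p y * Derive p y); [rewrite <- Hode |]; ring.
- ring.
Qed.

(** * Fourier coefficients *)

Definition cos_coef (p : R -> R) (k : Z) : R :=
  RInt (fun x => p x * cos (IZR k * x)) 0 (2 * PI).

Definition sin_coef (p : R -> R) (k : Z) : R :=
  RInt (fun x => p x * sin (IZR k * x)) 0 (2 * PI).

Lemma continuous_cos_linear (a x : R) : continuous (fun y => cos (a * y)) x.
Proof. apply (ex_derive_continuous (fun y => cos (a * y))). auto_derive. auto. Qed.

Lemma continuous_sin_linear (a x : R) : continuous (fun y => sin (a * y)) x.
Proof. apply (ex_derive_continuous (fun y => sin (a * y))). auto_derive. auto. Qed.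

Lemma ex_RInt_mul_cos (p : R -> R) (w a b : R) :
  (forall x, continuous p x) -> ex_RInt (fun x => p x * cos (w * x)) a b.
Proof.
intros Hp. apply (ex_RInt_continuous (V := R_CompleteNormedModule)). intros x _.
apply (continuous_mult p); [apply Hp | apply continuous_cos_linear].
Qed.

Lemma ex_RInt_mul_sin (p : R -> R) (w a b : R) :
  (forall x, continuous p x) -> ex_RInt (fun x => p x * sin (w * x)) a b.
Proof.
intros Hp. apply (ex_RInt_continuous (V := R_CompleteNormedModule)). intros x _.
apply (continuous_mult p); [apply Hp | apply continuous_sin_linear].
Qed.

Lemma cos_coef_opp (p : R -> R) (k : Z) : cos_coef p (- k) = cos_coef p k.
Proof.
apply RInt_ext. intros x _. rewrite opp_IZR.
replace (- IZR k * x) with (- (IZR k * x)) by ring. now rewrite cos_neg.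
Qed.

Lemma sin_coef_opp (p : R -> R) (k : Z) :
  (forall x, continuous p x) -> sin_coef p (- k) = - sin_coef p k.
Proof.
intros Hp. unfold sin_coef.
rewrite <- (RInt_opp (V := R_CompleteNormedModule)) by now apply ex_RInt_mul_sin.
apply RInt_ext. intros x _. rewrite opp_IZR.
replace (- IZR k * x) with (- (IZR k * x)) by ring. rewrite sin_neg.
unfold opp; simpl. ring.
Qed.

Lemma cos_coef_minus (p q : R -> R) (k : Z) :
  (forall x, continuous p x) -> (forall x, continuous q x) ->
  cos_coef (fun x => p x - q x) k = cos_coef p k - cos_coef q k.
Proof.
intros Hp Hq. unfold cos_coef.
rewrite <- (RInt_minus (V := R_CompleteNormedModule)) by now apply ex_RInt_mul_cos.
apply RInt_ext. intros x _. unfold minus, plus, opp; simpl. ring.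
Qed.

Lemma sin_coef_minus (p q : R -> R) (k : Z) :
  (forall x, continuous p x) -> (forall x, continuous q x) ->
  sin_coef (fun x => p x - q x) k = sin_coef p k - sin_coef q k.
Proof.
intros Hp Hq. unfold sin_coef.
rewrite <- (RInt_minus (V := R_CompleteNormedModule)) by now apply ex_RInt_mul_sin.
apply RInt_ext. intros x _. unfold minus, plus, opp; simpl. ring.
Qed.

Lemma RInt_period_translate (g : R -> R) (h : R) :
  (forall x, continuous g x) -> (forall x, g (x + 2 * PI) = g x) ->
  RInt (fun x => g (x + h)) 0 (2 * PI) = RInt g 0 (2 * PI).
Proof.
intros Hg Hper.
assert (Hex : forall a b, ex_RInt g a b).
{ intros a b. apply (ex_RInt_continuous (V := R_CompleteNormedModule)). intros x _. apply Hg. }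
assert (Htr : forall v a b, RInt (fun x => g (x + v)) a b = RInt g (a + v) (b + v)).
{ intros v a b.
  assert (H := RInt_comp_lin (V := R_CompleteNormedModule) g 1 v a b (Hex _ _)).
  rewrite !Rmult_1_l in H. rewrite <- H. apply RInt_ext. intros x _.
  unfold scal; simpl; unfold mult; simpl. rewrite !Rmult_1_l. reflexivity. }
rewrite Htr, Rplus_0_l.
assert (Hh : RInt g (0 + 2 * PI) (h + 2 * PI) = RInt g 0 h).
{ rewrite <- Htr. apply RInt_ext. intros x _. apply Hper. }
assert (H1 := RInt_Chasles (V := R_CompleteNormedModule) g 0 h (2 * PI + h) (Hex _ _) (Hex _ _)).
assert (H2 := RInt_Chasles (V := R_CompleteNormedModule) g 0 (2 * PI) (2 * PI + h) (Hex _ _) (Hex _ _)).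
unfold plus in H1, H2; simpl in H1, H2.
rewrite Rplus_0_l, (Rplus_comm h) in Hh. lra.
Qed.

Lemma cos_period_Z (x : R) (k : Z) : cos (x + 2 * IZR k * PI) = cos x.
Proof.
destruct (Z_le_gt_dec 0 k) as [Hk|Hk].
- rewrite <- (Z2Nat.id k Hk), <- INR_IZR_INZ. apply cos_period.
- rewrite <- (cos_period _ (Z.to_nat (- k))), INR_IZR_INZ, Z2Nat.id by lia.
  rewrite opp_IZR. f_equal. ring.
Qed.

Lemma sin_period_Z (x : R) (k : Z) : sin (x + 2 * IZR k * PI) = sin x.
Proof.
rewrite <- !cos_shift. rewrite <- (cos_period_Z (PI / 2 - x) (- k)), opp_IZR.
f_equal. ring.
Qed.

Lemma cos_mode_period (k : Z) (x : R) : cos (IZR k * (x + 2 * PI)) = cos (IZR k * x).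
Proof. rewrite <- (cos_period_Z (IZR k * x) k). f_equal. ring. Qed.

Lemma sin_mode_period (k : Z) (x : R) : sin (IZR k * (x + 2 * PI)) = sin (IZR k * x).
Proof. rewrite <- (sin_period_Z (IZR k * x) k). f_equal. ring. Qed.

Lemma RInt_lin2 (f g : R -> R) (a b c d : R) :
  ex_RInt f a b -> ex_RInt g a b ->
  RInt (fun x => c * f x + d * g x) a b = c * RInt f a b + d * RInt g a b.
Proof.
intros Hf Hg. apply is_RInt_unique.
apply (is_RInt_plus (V := R_NormedModule)); apply (is_RInt_scal (V := R_NormedModule));
  now apply (RInt_correct (V := R_CompleteNormedModule)).
Qed.

Section Translation.

Context (p : R -> R) (h : R) (k : Z).
Hypothesis Hp : forall x, continuous p x.
Hypothesis Hper : forall x, p (x + 2 * PI) = p x.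

Lemma cos_coef_translate :
  cos_coef (fun x => p (x + h)) k =
  cos (IZR k * h) * cos_coef p k + sin (IZR k * h) * sin_coef p k.
Proof.
unfold cos_coef, sin_coef.
rewrite <- (RInt_lin2 (fun x => p x * cos (IZR k * x)) (fun x => p x * sin (IZR k * x)) 0 (2 * PI) (cos (IZR k * h)) (sin (IZR k * h))); [|now apply ex_RInt_mul_cos | now apply ex_RInt_mul_sin].
rewrite <- (RInt_period_translate (fun x => cos (IZR k * h) * (p x * cos (IZR k * x)) + sin (IZR k * h) * (p x * sin (IZR k * x))) h).
- apply RInt_ext. intros x _.
  replace (IZR k * x) with (IZR k * (x + h) - IZR k * h) at 1 by ring.
  rewrite cos_minus. simpl. ring.
- intros x. apply (continuous_plus (V := R_NormedModule)); apply (continuous_scal_r (V := R_NormedModule));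
    apply (continuous_mult p); auto using continuous_cos_linear, continuous_sin_linear.
- intros x. now rewrite Hper, cos_mode_period, sin_mode_period.
Qed.

Lemma sin_coef_translate :
  sin_coef (fun x => p (x + h)) k =
  cos (IZR k * h) * sin_coef p k - sin (IZR k * h) * cos_coef p k.
Proof.
unfold Rminus. rewrite Ropp_mult_distr_l. unfold cos_coef, sin_coef.
rewrite <- (RInt_lin2 (fun x => p x * sin (IZR k * x)) (fun x => p x * cos (IZR k * x)) 0 (2 * PI) (cos (IZR k * h)) (- sin (IZR k * h))); [|now apply ex_RInt_mul_sin | now apply ex_RInt_mul_cos].
rewrite <- (RInt_period_translate (fun x => cos (IZR k * h) * (p x * sin (IZR k * x)) + - sin (IZR k * h) * (p x * cos (IZR k * x))) h).
- apply RInt_ext. intros x _.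
  replace (IZR k * x) with (IZR k * (x + h) - IZR k * h) at 1 by ring.
  rewrite sin_minus. simpl. ring.
- intros x. apply (continuous_plus (V := R_NormedModule)); apply (continuous_scal_r (V := R_NormedModule));
    apply (continuous_mult p); auto using continuous_cos_linear, continuous_sin_linear.
- intros x. now rewrite Hper, cos_mode_period, sin_mode_period.
Qed.

End Translation.

Lemma sparse_coefs (p : R -> R) (N : nat) (k : Z) :
  (0 < N)%nat -> (forall x, continuous p x) ->
  (forall x, p (x + 2 * PI) = p x) -> (forall x, p (x + 2 * PI / INR N) = p x) ->
  ~ (Z.of_nat N | k)%Z -> cos_coef p k = 0 /\ sin_coef p k = 0.
Proof.
intros HN Hp Hper HperN Hk.
assert (HN' : 0 < INR N) by now apply lt_0_INR.
set (th := IZR k * (2 * PI / INR N)).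
assert (Hc : cos_coef p k = cos th * cos_coef p k + sin th * sin_coef p k).
{ unfold th. rewrite <- cos_coef_translate by assumption.
  apply RInt_ext. intros x _. now rewrite HperN. }
assert (Hs : sin_coef p k = cos th * sin_coef p k - sin th * cos_coef p k).
{ unfold th. rewrite <- sin_coef_translate by assumption.
  apply RInt_ext. intros x _. now rewrite HperN. }
assert (Hth : cos th <> 1).
{ intros H. apply Hk.
  replace th with (2 * (IZR k * PI / INR N)) in H by (unfold th; field; lra).
  rewrite cos_2a_sin in H.
  assert (Hsin : sin (IZR k * PI / INR N) = 0) by nra.
  apply sin_eq_0_0 in Hsin. destruct Hsin as [j Hj]. exists j.
  apply eq_IZR. rewrite mult_IZR, <- INR_IZR_INZ.
  assert (HPI := PI_RGT_0). apply (Rmult_eq_reg_r (PI / INR N)).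
  - replace (IZR k * (PI / INR N)) with (IZR k * PI / INR N) by (field; lra). rewrite Hj. field. lra.
  - apply Rgt_not_eq. now apply Rdiv_lt_0_compat. }
assert (Hsq : (1 - cos th) * (cos_coef p k ^ 2 + sin_coef p k ^ 2) = 0) by nra.
apply Rmult_integral in Hsq. destruct Hsq as [Hsq|Hsq]; [lra|]. split; nra.
Qed.

Lemma RInt_le_sup (f : R -> R) (M : R) :
  ex_RInt f 0 (2 * PI) -> (forall x, Rabs (f x) <= M) ->
  Rabs (RInt f 0 (2 * PI)) <= 2 * PI * M.
Proof.
intros Hf HM. assert (HPI := PI_RGT_0).
replace (2 * PI * M) with ((2 * PI - 0) * M) by ring.
apply abs_RInt_le_const; [lra | exact Hf | intros t _; apply HM].
Qed.

Lemma Rabs_mul_le_l (a b M : R) : Rabs a <= M -> Rabs b <= 1 -> Rabs (a * b) <= M.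
Proof.
intros Ha Hb. rewrite Rabs_mult. assert (H := Rabs_pos a). assert (H' := Rabs_pos b). nra.
Qed.

Lemma Rabs_cos_le (x : R) : Rabs (cos x) <= 1.
Proof. apply Rabs_le, COS_bound. Qed.

Lemma Rabs_sin_le (x : R) : Rabs (sin x) <= 1.
Proof. apply Rabs_le, SIN_bound. Qed.

Lemma cos_coef_le_sup (p : R -> R) (M : R) (k : Z) :
  (forall x, continuous p x) -> (forall x, Rabs (p x) <= M) ->
  Rabs (cos_coef p k) <= 2 * PI * M.
Proof.
intros Hp HM. apply RInt_le_sup; [now apply ex_RInt_mul_cos |].
intros x. apply Rabs_mul_le_l; [apply HM | apply Rabs_cos_le].
Qed.

Lemma sin_coef_le_sup (p : R -> R) (M : R) (k : Z) :
  (forall x, continuous p x) -> (forall x, Rabs (p x) <= M) ->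
  Rabs (sin_coef p k) <= 2 * PI * M.
Proof.
intros Hp HM. apply RInt_le_sup; [now apply ex_RInt_mul_sin |].
intros x. apply Rabs_mul_le_l; [apply HM | apply Rabs_sin_le].
Qed.

Lemma coef_0 (k : Z) : cos_coef (fun _ => 0) k = 0 /\ sin_coef (fun _ => 0) k = 0.
Proof.
assert (Hcont : forall x : R, continuous (fun _ : R => 0) x) by (intros x; apply continuous_const).
assert (H : forall x : R, Rabs ((fun _ => 0) x) <= 0) by (intros _; rewrite Rabs_R0; lra).
assert (H1 := sin_coef_le_sup _ 0 k Hcont H). assert (H2 := cos_coef_le_sup _ 0 k Hcont H).
rewrite Rmult_0_r in H1, H2. split; apply Rabs_eq_0, Rle_antisym; auto using Rabs_pos.
Qed.

Lemma RInt_of_derive (F f : R -> R) :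
  (forall x, is_derive F x (f x)) -> (forall x, continuous f x) ->
  RInt f 0 (2 * PI) = F (2 * PI) - F 0.
Proof.
intros HF Hf. apply is_RInt_unique.
apply (is_RInt_derive (V := R_CompleteNormedModule)); intros x _; [apply HF | apply Hf].
Qed.

Section SecondDerivative.

Context (p : R -> R) (k : Z).
Hypothesis Hp : smooth p.
Hypothesis Hper : forall x, p (x + 2 * PI) = p x.
Hypothesis Hk : k <> 0%Z.

Let HkR : IZR k <> 0.
Proof. now apply not_0_IZR. Qed.

Let Hper0 : p (2 * PI) = p 0.
Proof. rewrite <- (Hper 0). f_equal. ring. Qed.

Let Hper1 : Derive p (2 * PI) = Derive p 0.
Proof.
transitivity (Derive (fun x => p (x + 2 * PI)) 0); [|apply Derive_ext, Hper].
replace (2 * PI) with (0 + 2 * PI) at 1 by ring.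
symmetry. exact (Derive_n_comp_trans p 1 0 (2 * PI)).
Qed.

Let Hp0 x : continuous p x.
Proof. now apply smooth_continuous. Qed.

Let Hp2 x : continuous (Derive_n p 2) x.
Proof. apply (ex_derive_continuous (Derive_n p 2)), (Hp 3%nat). Qed.

Let HD0 x : is_derive p x (Derive p x).
Proof. exact (smooth_Derive_n p 0 x Hp). Qed.

Let HD1 x : is_derive (Derive p) x (Derive_n p 2 x).
Proof. exact (smooth_Derive_n p 1 x Hp). Qed.

Lemma cos_coef_Derive2 : cos_coef (Derive_n p 2) k = - IZR k ^ 2 * cos_coef p k.
Proof.
enough (H : 1 * cos_coef p k + / (IZR k ^ 2) * cos_coef (Derive_n p 2) k = 0).
{ replace (cos_coef (Derive_n p 2) k)
    with (IZR k ^ 2 * (1 * cos_coef p k + / IZR k ^ 2 * cos_coef (Derive_n p 2) k)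
          - IZR k ^ 2 * cos_coef p k) by (field; exact HkR).
  rewrite H. ring. }
unfold cos_coef.
rewrite <- (RInt_lin2 (fun x => p x * cos (IZR k * x)) (fun x => Derive_n p 2 x * cos (IZR k * x))
  0 (2 * PI) 1 (/ IZR k ^ 2)) by now apply ex_RInt_mul_cos.
rewrite (RInt_of_derive (fun x => p x * sin (IZR k * x) / IZR k
         + Derive p x * cos (IZR k * x) / IZR k ^ 2)).
- replace (2 * PI) with (0 + 2 * PI) by ring.
  rewrite cos_mode_period, sin_mode_period, Rplus_0_l, Hper0, Hper1. ring.
- intros x. assert (H0 := HD0 x). assert (H1 := HD1 x).
  auto_derive; [split; [eexists; exact H0 | split; [eexists; exact H1 | exact I]]|].
  change (Derive (fun x0 => Derive p x0) x) with (Derive_n p 2 x).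
  change (Derive (fun x => p x) x) with (Derive p x). field. exact HkR.
- intros x. apply (continuous_plus (V := R_NormedModule)); apply (continuous_scal_r (V := R_NormedModule));
    apply (continuous_mult (K := R_AbsRing)); auto using continuous_cos_linear.
Qed.

Lemma sin_coef_Derive2 : sin_coef (Derive_n p 2) k = - IZR k ^ 2 * sin_coef p k.
Proof.
enough (H : 1 * sin_coef p k + / (IZR k ^ 2) * sin_coef (Derive_n p 2) k = 0).
{ replace (sin_coef (Derive_n p 2) k)
    with (IZR k ^ 2 * (1 * sin_coef p k + / IZR k ^ 2 * sin_coef (Derive_n p 2) k)
          - IZR k ^ 2 * sin_coef p k) by (field; exact HkR).
  rewrite H. ring. }
unfold sin_coef.
rewrite <- (RInt_lin2 (fun x => p x * sin (IZR k * x)) (fun x => Derive_n p 2 x * sin (IZR k * x))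
  0 (2 * PI) 1 (/ IZR k ^ 2)) by now apply ex_RInt_mul_sin.
rewrite (RInt_of_derive (fun x => - (p x * cos (IZR k * x) / IZR k)
         + Derive p x * sin (IZR k * x) / IZR k ^ 2)).
- replace (2 * PI) with (0 + 2 * PI) by ring.
  rewrite cos_mode_period, sin_mode_period, Rplus_0_l, Hper0, Hper1. ring.
- intros x. assert (H0 := HD0 x). assert (H1 := HD1 x).
  auto_derive; [split; [eexists; exact H0 | split; [eexists; exact H1 | exact I]]|].
  change (Derive (fun x0 => Derive p x0) x) with (Derive_n p 2 x).
  change (Derive (fun x => p x) x) with (Derive p x). field. exact HkR.
- intros x. apply (continuous_plus (V := R_NormedModule)); apply (continuous_scal_r (V := R_NormedModule));
    apply (continuous_mult (K := R_AbsRing)); auto using continuous_sin_linear.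
Qed.

Lemma cos_coef_decay (M : R) :
  (forall x, Rabs (Derive_n p 2 x) <= M) -> Rabs (cos_coef p k) <= 2 * PI * M / IZR k ^ 2.
Proof.
intros HM. assert (Hk2 : 0 < IZR k ^ 2) by (apply pow2_gt_0, HkR).
apply Rle_div_r; [exact Hk2|].
rewrite <- (Rabs_pos_eq (IZR k ^ 2)) by lra. rewrite <- Rabs_mult, <- Rabs_Ropp.
replace (- (cos_coef p k * IZR k ^ 2)) with (cos_coef (Derive_n p 2) k)
  by (rewrite cos_coef_Derive2; ring).
now apply cos_coef_le_sup.
Qed.

Lemma sin_coef_decay (M : R) :
  (forall x, Rabs (Derive_n p 2 x) <= M) -> Rabs (sin_coef p k) <= 2 * PI * M / IZR k ^ 2.
Proof.
intros HM. assert (Hk2 : 0 < IZR k ^ 2) by (apply pow2_gt_0, HkR).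
apply Rle_div_r; [exact Hk2|].
rewrite <- (Rabs_pos_eq (IZR k ^ 2)) by lra. rewrite <- Rabs_mult, <- Rabs_Ropp.
replace (- (sin_coef p k * IZR k ^ 2)) with (sin_coef (Derive_n p 2) k)
  by (rewrite sin_coef_Derive2; ring).
now apply sin_coef_le_sup.
Qed.

End SecondDerivative.

Lemma fourier_coefs (f : R -> C) (k : Z) :
  (forall x, continuous (fun y => Re (f y)) x) ->
  (forall x, continuous (fun y => Im (f y)) x) ->
  fourier f k =
  (/ (2 * PI) * (cos_coef (fun x => Re (f x)) k + sin_coef (fun x => Im (f x)) k),
   / (2 * PI) * (cos_coef (fun x => Im (f x)) k - sin_coef (fun x => Re (f x)) k)).
Proof.
intros HRe HIm.
assert (H : is_RInt (V := C_R_CompleteNormedModule)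
  (fun x => (f x * (cos (IZR k * x), - sin (IZR k * x))%R)%C) 0 (2 * PI)
  (cos_coef (fun x => Re (f x)) k + sin_coef (fun x => Im (f x)) k,
   cos_coef (fun x => Im (f x)) k - sin_coef (fun x => Re (f x)) k)).
{ apply (is_RInt_fct_extend_pair (U := R_NormedModule) (V := R_NormedModule)).
  - apply (is_RInt_ext (fun x => plus (Re (f x) * cos (IZR k * x)) (Im (f x) * sin (IZR k * x)))).
    + intros x _. unfold plus; simpl. unfold Re, Im. ring.
    + apply (is_RInt_plus (V := R_NormedModule)); apply (RInt_correct (V := R_CompleteNormedModule));
        [now apply (ex_RInt_mul_cos (fun x => Re (f x))) | now apply (ex_RInt_mul_sin (fun x => Im (f x)))].
  - apply (is_RInt_ext (fun x => minus (Im (f x) * cos (IZR k * x)) (Re (f x) * sin (IZR k * x)))).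
    + intros x _. unfold minus, plus, opp; simpl. unfold Re, Im. ring.
    + apply (is_RInt_minus (V := R_NormedModule)); apply (RInt_correct (V := R_CompleteNormedModule));
        [now apply (ex_RInt_mul_cos (fun x => Im (f x))) | now apply (ex_RInt_mul_sin (fun x => Re (f x)))]. }
unfold fourier. rewrite (is_RInt_unique (V := C_R_CompleteNormedModule) _ _ _ _ H).
apply injective_projections; simpl; ring.
Qed.

(** * Sobolev norms of oscillating profiles *)

Definition oscillating (N : nat) (D : R) (p : R -> R) : Prop :=
  smooth p /\ (forall x, p (x + 2 * PI / INR N) = p x) /\
  (forall x, Rabs (Derive_n p 2 x) <= D * INR N ^ 2).

Lemma periodic_iter (p : R -> R) (T : R) (n : nat) (x : R) :
  (forall x, p (x + T) = p x) -> p (x + INR n * T) = p x.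
Proof.
intros Hp. induction n as [|n IH].
- f_equal. simpl. ring.
- rewrite S_INR. replace (x + (INR n + 1) * T) with (x + INR n * T + T) by ring. now rewrite Hp.
Qed.

Lemma oscillating_period (N : nat) (D : R) (p : R -> R) :
  (0 < N)%nat -> oscillating N D p -> forall x, p (x + 2 * PI) = p x.
Proof.
intros HN (_ & Hper & _) x. rewrite <- (periodic_iter p (2 * PI / INR N) N x Hper).
f_equal. field. now apply not_0_INR, Nat.neq_0_lt_0.
Qed.

Lemma oscillating_translate (N : nat) (D : R) (p : R -> R) (h : R) :
  oscillating N D p -> oscillating N D (fun x => p (x + h)).
Proof.
intros (Hp & Hper & HD). split; [|split].
- now apply smooth_translate.
- intros x. rewrite <- (Hper (x + h)). f_equal. ring.
- intros x. rewrite Derive_n_comp_trans. apply HD.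
Qed.

Lemma Derive_n_smooth_minus (p q : R -> R) (n : nat) (x : R) :
  smooth p -> smooth q ->
  Derive_n (fun y => p y - q y) n x = Derive_n p n x - Derive_n q n x.
Proof.
intros Hp Hq. apply Derive_n_minus; apply filter_forall; intros y k _; [apply Hp | apply Hq].
Qed.

Lemma oscillating_minus (N : nat) (D D' : R) (p q : R -> R) :
  oscillating N D p -> oscillating N D' q -> oscillating N (D + D') (fun x => p x - q x).
Proof.
intros (Hp & Hpper & HD) (Hq & Hqper & HD'). split; [|split].
- now apply smooth_minus.
- intros x. now rewrite Hpper, Hqper.
- intros x. rewrite Derive_n_smooth_minus by assumption.
  specialize (HD x); specialize (HD' x).
  unfold Rminus. eapply Rle_trans; [apply Rabs_triang|]. rewrite Rabs_Ropp. lra.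
Qed.

Lemma oscillating_0 (N : nat) (D : R) : 0 <= D -> oscillating N D (fun _ => 0).
Proof.
intros HD. split; [apply smooth_const | split; [reflexivity|]].
intros x. rewrite Derive_n_const, Rabs_R0. apply Rmult_le_pos; [exact HD | apply pow2_ge_0].
Qed.

Lemma Cmod_sqr (z : C) : (Cmod z ^ 2 = Re z ^ 2 + Im z ^ 2)%R.
Proof.
unfold Cmod. rewrite pow2_sqrt; [reflexivity|].
apply Rplus_le_le_0_compat; apply pow2_ge_0.
Qed.

Definition oscillating_profile (N : nat) (D : R) (f : R -> C) : Prop :=
  (0 < N)%nat /\ oscillating N D (fun x => Re (f x)) /\ oscillating N D (fun x => Im (f x)).

Section Coefficients.

Context (N : nat) (D : R) (f : R -> C).
Hypothesis Hf : oscillating_profile N D f.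

Lemma oscillating_profile_smooth : smooth_profile f.
Proof.
destruct Hf as (HN & HRe & HIm). split; [|split; [apply HRe | apply HIm]].
intros x. apply injective_projections;
  [apply (oscillating_period N D _ HN HRe) | apply (oscillating_period N D _ HN HIm)].
Qed.

Lemma fourier_profile (k : Z) :
  fourier f k =
  (/ (2 * PI) * (cos_coef (fun x => Re (f x)) k + sin_coef (fun x => Im (f x)) k),
   / (2 * PI) * (cos_coef (fun x => Im (f x)) k - sin_coef (fun x => Re (f x)) k)).
Proof.
destruct Hf as (_ & (HRe & _) & (HIm & _)).
apply fourier_coefs; intros x; now apply (smooth_continuous (fun _ => _)).
Qed.

Lemma fourier_sparse (k : Z) : ~ (Z.of_nat N | k)%Z -> fourier f k = 0.
Proof.
intros Hk. rewrite fourier_profile. destruct Hf as (HN & HRe & HIm).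
destruct (sparse_coefs (fun x => Re (f x)) N k HN) as [H1 H2]; try exact Hk.
{ intros x. apply (smooth_continuous (fun _ => _)), HRe. }
{ exact (oscillating_period N D _ HN HRe). }
{ apply HRe. }
destruct (sparse_coefs (fun x => Im (f x)) N k HN) as [H3 H4]; try exact Hk.
{ intros x. apply (smooth_continuous (fun _ => _)), HIm. }
{ exact (oscillating_period N D _ HN HIm). }
{ apply HIm. }
rewrite H1, H2, H3, H4. apply injective_projections; simpl; ring.
Qed.

Lemma fourier_decay (k : Z) :
  k <> 0%Z -> Cmod (fourier f k) ^ 2 <= 8 * D ^ 2 * INR N ^ 4 / IZR k ^ 4.
Proof.
intros Hk. destruct Hf as (HN & HRe & HIm). assert (HPI := PI_RGT_0).
assert (Hk2 : 0 < IZR k ^ 2) by (apply pow2_gt_0, not_0_IZR, Hk).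
set (M := D * INR N ^ 2 / IZR k ^ 2).
assert (Hcomb : forall a b, Rabs a <= 2 * PI * (D * INR N ^ 2) / IZR k ^ 2 ->
  Rabs b <= 2 * PI * (D * INR N ^ 2) / IZR k ^ 2 -> Rabs (/ (2 * PI) * (a + b)) <= 2 * M).
{ intros a b Ha Hb. rewrite Rabs_mult, Rabs_pos_eq by (left; apply Rinv_0_lt_compat; lra).
  apply (Rmult_le_reg_l (2 * PI)); [lra|].
  rewrite <- Rmult_assoc, Rinv_r, Rmult_1_l by lra.
  eapply Rle_trans; [apply Rabs_triang|].
  replace (2 * PI * (2 * M)) with (2 * (2 * PI * (D * INR N ^ 2) / IZR k ^ 2))
    by (unfold M; field; apply not_0_IZR, Hk).
  lra. }
assert (Hsq : forall x, Rabs x <= 2 * M -> x ^ 2 <= 4 * M ^ 2).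
{ intros x Hx. rewrite <- (pow2_abs x). assert (H := Rabs_pos x). nra. }
rewrite Cmod_sqr, fourier_profile.
replace (8 * D ^ 2 * INR N ^ 4 / IZR k ^ 4) with (4 * M ^ 2 + 4 * M ^ 2)
  by (unfold M; field; apply not_0_IZR, Hk).
assert (HperRe := oscillating_period N D _ HN HRe).
assert (HperIm := oscillating_period N D _ HN HIm).
apply Rplus_le_compat; apply Hsq; simpl Re; simpl Im.
- apply Hcomb; [apply (cos_coef_decay (fun x => Re (f x))) | apply (sin_coef_decay (fun x => Im (f x)))];
    first [exact Hk | assumption | apply HRe | apply HIm].
- apply Hcomb; [apply (cos_coef_decay (fun x => Im (f x))) |
    rewrite Rabs_Ropp; apply (sin_coef_decay (fun x => Re (f x)))];
    first [exact Hk | assumption | apply HRe | apply HIm].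
Qed.

End Coefficients.

Lemma Rpower_le_1 (x s : R) : 1 <= x -> s <= 1 -> Rpower x s <= x.
Proof.
intros Hx Hs. rewrite <- (Rpower_1 x) at 2 by lra. destruct Hx as [Hx|Hx].
- now apply Rle_Rpower; [left|].
- subst x. unfold Rpower. rewrite ln_1, !Rmult_0_r. apply Rle_refl.
Qed.

Lemma Rpower_pos (x s : R) : 0 < Rpower x s.
Proof. apply exp_pos. Qed.

Lemma Rpower_antitone (x y s : R) : 0 < x -> x <= y -> s <= 0 -> Rpower y s <= Rpower x s.
Proof.
intros Hx Hxy Hs. replace s with (- (- s)) by ring. rewrite !(Rpower_Ropp _ (- s)).
apply Rinv_le_contravar; [apply Rpower_pos|]. apply Rle_Rpower_l; lra.
Qed.

Lemma weight_le (s n q : R) :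
  s <= 1 -> 1 <= n -> n <= q -> Rpower (1 + q) s <= 2 * Rpower n s * (q / n).
Proof.
intros Hs Hn Hq.
assert (Hqn : 1 <= q / n) by (apply Rle_div_r; lra).
assert (Hpos := Rpower_pos n s).
destruct (Rle_dec 0 s) as [H0|H0].
- apply Rle_trans with (Rpower (2 * (n * (q / n))) s).
  + apply Rle_Rpower_l; [exact H0|]. replace (n * (q / n)) with q by (field; lra). lra.
  + rewrite <- (Rpower_mult_distr 2) by nra. rewrite <- Rpower_mult_distr by lra.
    assert (H2 := Rpower_le_1 2 s ltac:(lra) Hs). assert (H3 := Rpower_le_1 _ s Hqn Hs).
    assert (H4 := Rpower_pos 2 s). assert (H5 := Rpower_pos (q / n) s).
    rewrite Rmult_assoc. apply Rmult_le_compat; nra.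
- apply Rle_trans with (Rpower n s); [apply Rpower_antitone; lra | nra].
Qed.

Lemma weight_ge (s n : R) :
  1 <= n -> Rpower 2 (- Rabs s) * Rpower n s <= Rpower (1 + n) s.
Proof.
intros Hn. assert (Hpos := Rpower_pos n s). destruct (Rle_dec 0 s) as [H0|H0].
- rewrite Rabs_pos_eq by exact H0.
  assert (H1 : Rpower n s <= Rpower (1 + n) s) by (apply Rle_Rpower_l; lra).
  assert (H2 : Rpower 2 (- s) <= Rpower 2 0) by (apply Rle_Rpower; lra).
  rewrite Rpower_O in H2 by lra. nra.
- rewrite Rabs_left1, Ropp_involutive by lra.
  rewrite Rpower_mult_distr by lra. apply Rpower_antitone; lra.
Qed.

Lemma series_bounded (a : nat -> R) (M : R) :
  (forall n, 0 <= a n) -> (forall n, sum_n a n <= M) -> ex_series a /\ Series a <= M.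
Proof.
intros Ha HM.
assert (Hex : ex_finite_lim_seq (sum_n a)).
{ apply (ex_finite_lim_seq_incr _ M); [|exact HM].
  intros n. rewrite sum_Sn. unfold plus; simpl. specialize (Ha (S n)). lra. }
destruct Hex as [l Hl]. assert (Hs : is_series a l) by exact Hl.
split; [now exists l|]. rewrite (is_series_unique _ _ Hs).
apply (is_lim_seq_le (sum_n a) (fun _ => M) l M HM Hl (is_lim_seq_const M)).
Qed.

Definition multiple_weight (N i : nat) : R :=
  if (S i mod N =? 0)%nat then (INR N / INR (S i)) ^ 2 else 0.

(* The bound [2 - 1/q], with [q] the number of multiples of N met so far, is the
   telescoping bound on [sum 1/j^2]. *)
Lemma multiple_weight_sum_aux (N n : nat) : (0 < N)%nat ->
  let q := (S n / N)%nat in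
  ((q = 0)%nat -> sum_n (multiple_weight N) n <= 0) /\
  ((0 < q)%nat -> sum_n (multiple_weight N) n <= 2 - / INR q).
Proof.
intros HN. induction n as [|n [IH0 IH1]]; intros q.
- rewrite sum_O. unfold multiple_weight.
  destruct (Nat.eq_dec N 1) as [->|HN1].
  + unfold q. simpl. split; [discriminate|]. intros _. lra.
  + rewrite Nat.mod_small by lia. unfold q. rewrite Nat.div_small by lia. simpl.
    split; intros H; [lra | lia].
- rewrite sum_Sn. unfold plus; simpl AbelianMonoid.plus. simpl.
  assert (HD := Nat.div_mod (S n) N ltac:(lia)). assert (Hm := Nat.mod_upper_bound (S n) N ltac:(lia)).
  assert (HD' := Nat.div_mod (S (S n)) N ltac:(lia)). assert (Hm' := Nat.mod_upper_bound (S (S n)) N ltac:(lia)).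
  fold q in HD'. set (q0 := (S n / N)%nat) in *.
  unfold multiple_weight at 2 4. destruct (Nat.eqb_spec (S (S n) mod N) 0) as [Hz|Hz].
  + assert (Hq : q = S q0) by nia. split; [lia|]. intros _.
    replace (INR N / INR (S (S n))) with (/ INR (S q0)).
    2:{ rewrite HD', Hz, Hq, Nat.add_0_r, mult_INR. field. split; apply not_0_INR; lia. }
    rewrite Hq.
    destruct (Nat.eq_dec q0 0) as [Hq0|Hq0].
    * rewrite Hq0. specialize (IH0 Hq0). simpl. lra.
    * specialize (IH1 ltac:(lia)).
      assert (Hpos : 0 < INR q0) by (apply lt_0_INR; lia).
      rewrite S_INR. apply Rle_trans with (2 - / INR q0 + (/ (INR q0 + 1)) ^ 2); [lra|].
      enough ((/ (INR q0 + 1)) ^ 2 + / (INR q0 + 1) <= / INR q0) by lra.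
      apply (Rmult_le_reg_r (INR q0 * (INR q0 + 1) ^ 2)); [nra|].
      field_simplify; [nra | lra | lra].
  + assert (Hq : q = q0) by nia. rewrite Hq, Rplus_0_r. split; assumption.
Qed.

Lemma multiple_weight_sum (N n : nat) : (0 < N)%nat -> sum_n (multiple_weight N) n <= 2.
Proof.
intros HN. destruct (multiple_weight_sum_aux N n HN) as [H0 H1].
destruct (Nat.eq_dec (S n / N) 0) as [Hq|Hq].
- specialize (H0 Hq). lra.
- assert (H : 0 < / INR (S n / N)) by (apply Rinv_0_lt_compat, lt_0_INR; lia).
  specialize (H1 ltac:(lia)). lra.
Qed.

Lemma Hs_term_pos (s : R) (a : Z -> C) (k : Z) : 0 <= Hs_term s a k.
Proof. apply Rmult_le_pos; [left; apply Rpower_pos | apply pow2_ge_0]. Qed.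

Lemma Hs_norm_ge_term (s : R) (a : Z -> C) (n : nat) :
  in_Hs s a -> sqrt (Hs_term s a (Z.of_nat n)) <= Hs_norm s a.
Proof.
intros [Hp Hn]. apply sqrt_le_1_alt.
assert (H1 : Hs_term s a (Z.of_nat n) <= Series (fun n => Hs_term s a (Z.of_nat n))).
{ rewrite (Series_incr_n _ (S n)) by (lia || exact Hp).
  simpl pred. rewrite <- sum_n_Reals.
  assert (H : 0 <= Series (fun k => Hs_term s a (Z.of_nat (S n + k)))).
  { rewrite <- (Rmult_0_l (Series (fun k => Hs_term s a (Z.of_nat (S n + k))))), <- Series_scal_l.
    apply Series_le.
    - intros k. rewrite Rmult_0_l. split; [apply Rle_refl | apply Hs_term_pos].
    - apply (ex_series_incr_n (fun k => Hs_term s a (Z.of_nat k)) (S n)), Hp. }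
  assert (Hs : Hs_term s a (Z.of_nat n) <= sum_n (fun n => Hs_term s a (Z.of_nat n)) n).
  { destruct n as [|n]; [rewrite sum_O; apply Rle_refl|]. rewrite sum_Sn. unfold plus; simpl.
    enough (0 <= sum_n (fun n => Hs_term s a (Z.of_nat n)) n) by lra.
    rewrite sum_n_Reals. apply cond_pos_sum. intros k. apply Hs_term_pos. }
  lra. }
assert (H2 : 0 <= Series (fun n => Hs_term s a (- Z.of_nat (S n))%Z)).
{ rewrite <- (Rmult_0_l (Series (fun n => Hs_term s a (- Z.of_nat (S n))%Z))), <- Series_scal_l.
  apply Series_le; [|exact Hn].
  intros k. rewrite Rmult_0_l. split; [apply Rle_refl | apply Hs_term_pos]. }
lra.
Qed.

Lemma Hs_term_oscillating (s : R) (N : nat) (D : R) (f : R -> C) (k : Z) (i : nat) :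
  s <= 1 -> oscillating_profile N D f -> Z.abs k = Z.of_nat (S i) ->
  Hs_term s (fourier f) k <= 16 * D ^ 2 * Rpower (INR N ^ 2) s * multiple_weight N i.
Proof.
intros Hs Hf Hk. assert (HN : (0 < N)%nat) by apply Hf. unfold multiple_weight, Hs_term.
assert (Hk2 : IZR k ^ 2 = INR (S i) ^ 2).
{ rewrite INR_IZR_INZ, <- Hk, abs_IZR. symmetry. apply pow2_abs. }
destruct (Nat.eqb_spec (S i mod N) 0) as [Hz|Hz].
- assert (HNi : (N <= S i)%nat).
  { apply Nat.divide_pos_le; [lia|]. now apply Nat.Lcm0.mod_divide. }
  assert (HN1 : 1 <= INR N) by (apply (le_INR 1); lia).
  assert (HNi' : INR N <= INR (S i)) by now apply le_INR.
  assert (Hdec := fourier_decay N D f Hf k ltac:(lia)).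
  replace (IZR k ^ 4) with ((IZR k ^ 2) ^ 2) in Hdec by ring.
  rewrite Hk2 in *.
  assert (Hw := weight_le s (INR N ^ 2) (INR (S i) ^ 2) Hs ltac:(nra) ltac:(nra)).
  assert (Hpw := Rpower_pos (INR N ^ 2) s).
  eapply Rle_trans.
  { apply Rmult_le_compat; [left; apply Rpower_pos | apply pow2_ge_0 | exact Hw | exact Hdec]. }
  apply Req_le. field. lra.
- rewrite (fourier_sparse N D f Hf).
  + rewrite Cmod_0. simpl. rewrite !Rmult_0_l, !Rmult_0_r. apply Rle_refl.
  + intros Hd. apply Hz. apply Z.divide_abs_r in Hd. rewrite Hk in Hd.
    apply Nat.Lcm0.mod_divide. destruct Hd as [j Hj]. exists (Z.to_nat j).
    assert (0 <= j)%Z by nia. nia.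
Qed.

Lemma series_oscillating (s : R) (N : nat) (D : R) (f : R -> C) (kappa : nat -> Z) :
  s <= 1 -> oscillating_profile N D f -> (forall i, Z.abs (kappa i) = Z.of_nat (S i)) ->
  ex_series (fun i => Hs_term s (fourier f) (kappa i)) /\
  Series (fun i => Hs_term s (fourier f) (kappa i)) <= 32 * D ^ 2 * Rpower (INR N ^ 2) s.
Proof.
intros Hs Hf Hk. apply series_bounded; [intros n; apply Hs_term_pos|]. intros n.
set (K := 16 * D ^ 2 * Rpower (INR N ^ 2) s).
assert (HK : 0 <= K).
{ apply Rmult_le_pos; [assert (H := pow2_ge_0 D); lra | left; apply Rpower_pos]. }
apply Rle_trans with (sum_n (fun i => multiple_weight N i * K) n).
- rewrite !sum_n_Reals. apply sum_Rle. intros i _.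
  rewrite Rmult_comm. now apply Hs_term_oscillating.
- rewrite sum_n_Reals, <- scal_sum, <- sum_n_Reals.
  assert (H := multiple_weight_sum N n ltac:(apply Hf)). unfold K in *. nra.
Qed.

Lemma Hs_norm_oscillating (s : R) (N : nat) (D : R) (f : R -> C) :
  s <= 1 -> 0 <= D -> oscillating_profile N D f ->
  in_Hs s (fourier f) /\
  Hs_norm s (fourier f) <= Cmod (fourier f 0) + 8 * D * Rpower (INR N) s.
Proof.
intros Hs HD Hf.
destruct (series_oscillating s N D f (fun i => Z.of_nat (S i)) Hs Hf) as [Hp HpB]; [lia|].
destruct (series_oscillating s N D f (fun i => (- Z.of_nat (S i))%Z) Hs Hf) as [Hn HnB]; [lia|].
assert (Hp0 : ex_series (fun i => Hs_term s (fourier f) (Z.of_nat i)))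
  by now apply ex_series_incr_1.
split; [now split|].
unfold Hs_norm. rewrite Series_incr_1 by exact Hp0.
assert (HN : 0 < INR N) by (apply lt_0_INR, Hf).
assert (Hpow : Rpower (INR N ^ 2) s = Rpower (INR N) s ^ 2).
{ simpl. rewrite !Rmult_1_r. symmetry. apply Rpower_mult_distr; assumption. }
rewrite Hpow in *.
assert (Hc := Cmod_ge_0 (fourier f 0)). assert (HX := Rpower_pos (INR N) s).
set (X := Rpower (INR N) s) in *.
rewrite <- (sqrt_pow2 (Cmod (fourier f 0) + 8 * D * X)) by (apply Rplus_le_le_0_compat; nra).
apply sqrt_le_1_alt.
assert (H0 : Hs_term s (fourier f) (Z.of_nat 0) = Cmod (fourier f 0) ^ 2).
{ unfold Hs_term. simpl Z.of_nat. replace (1 + IZR 0 ^ 2) with 1 by ring.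
  unfold Rpower. rewrite ln_1, Rmult_0_r, exp_0. ring. }
rewrite H0.
assert (0 <= Cmod (fourier f 0) * (D * X)) by (apply Rmult_le_pos; nra).
nra.
Qed.

(** * Decoherence *)

Definition profile_minus (f g : R -> C) (x : R) : C := (f x - g x)%C.

Lemma oscillating_profile_minus (N : nat) (D D' : R) (f g : R -> C) :
  oscillating_profile N D f -> oscillating_profile N D' g ->
  oscillating_profile N (D + D') (profile_minus f g).
Proof.
intros (HN & HRe & HIm) (_ & HRe' & HIm').
split; [exact HN | split; now apply oscillating_minus].
Qed.

Lemma fourier_profile_minus (N : nat) (D D' : R) (f g : R -> C) (k : Z) :
  oscillating_profile N D f -> oscillating_profile N D' g ->
  fourier (profile_minus f g) k = (fourier f k - fourier g k)%C.
Proof.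
intros Hf Hg. assert (Hfg := oscillating_profile_minus _ _ _ _ _ Hf Hg).
rewrite (fourier_profile _ _ _ Hf), (fourier_profile _ _ _ Hg), (fourier_profile _ _ _ Hfg).
destruct Hf as (_ & (HRe & _) & (HIm & _)). destruct Hg as (_ & (HRe' & _) & (HIm' & _)).
change (fun x => Re (profile_minus f g x)) with (fun x => Re (f x) - Re (g x)).
change (fun x => Im (profile_minus f g x)) with (fun x => Im (f x) - Im (g x)).
rewrite !cos_coef_minus, !sin_coef_minus by (intros x; now apply (smooth_continuous (fun _ => _))).
apply injective_projections; simpl; ring.
Qed.

Lemma oscillating_profile_wave (N : nat) (D c t : R) (f : R -> C) :
  oscillating_profile N D f -> oscillating_profile N D (wave c f t).
Proof.
intros (HN & HRe & HIm). split; [exact HN | split].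
- exact (oscillating_translate N D _ (- (c * t)) HRe).
- exact (oscillating_translate N D _ (- (c * t)) HIm).
Qed.

Lemma fourier_wave (N : nat) (D c t : R) (f : R -> C) (k : Z) :
  oscillating_profile N D f ->
  fourier (wave c f t) k =
  ((cos (IZR k * - (c * t)), sin (IZR k * - (c * t)))%R * fourier f k)%C.
Proof.
intros Hf. assert (Hw := oscillating_profile_wave N D c t f Hf).
rewrite (fourier_profile _ _ _ Hf), (fourier_profile _ _ _ Hw).
destruct Hf as (HN & HRe & HIm).
assert (HperRe := oscillating_period N D _ HN HRe).
assert (HperIm := oscillating_period N D _ HN HIm).
change (fun x => Re (wave c f t x)) with (fun x => Re (f (x + - (c * t)))).
change (fun x => Im (wave c f t x)) with (fun x => Im (f (x + - (c * t)))).
rewrite (cos_coef_translate (fun y => Re (f y))), (sin_coef_translate (fun y => Re (f y))),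
  (cos_coef_translate (fun y => Im (f y))), (sin_coef_translate (fun y => Im (f y)))
  by (try assumption; intros x; apply (smooth_continuous (fun _ => _)); first [apply HRe | apply HIm]).
apply injective_projections; simpl; ring.
Qed.

Lemma phase_space_profile (E : equation) (s : R) (N : nat) (D : R) (f : R -> C) :
  s <= 1 -> 0 <= D -> oscillating_profile N D f ->
  (real_valued E -> forall x, Im (f x) = 0) -> phase_space E s (fourier f).
Proof.
intros Hs HD Hf Hreal. split; [now apply (Hs_norm_oscillating s N D f)|].
intros HE k. rewrite !(fourier_profile _ _ _ Hf).
assert (H0 : (fun x => Im (f x)) = (fun _ => 0)).
{ apply functional_extensionality. intros x. now apply Hreal. }
rewrite H0, !cos_coef_opp, !sin_coef_opp.
- destruct (coef_0 k) as [-> ->]. unfold Cconj. simpl. f_equal; ring.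
- intros x. apply (smooth_continuous (fun _ => _)), Hf.
- intros x. apply continuous_const.
Qed.

Lemma Hs_norm_ge_mode (s : R) (N : nat) (a : Z -> C) (r : R) :
  (0 < N)%nat -> in_Hs s a -> 0 <= r -> r <= Cmod (a (Z.of_nat N)) * Rpower (INR N) s ->
  sqrt (Rpower 2 (- Rabs s)) * r <= Hs_norm s a.
Proof.
intros HN Ha Hr Hmode. apply Rle_trans with (2 := Hs_norm_ge_term s a N Ha).
rewrite <- (sqrt_pow2 r Hr), <- sqrt_mult_alt by (left; apply Rpower_pos).
apply sqrt_le_1_alt. unfold Hs_term. rewrite <- INR_IZR_INZ.
assert (HN1 : 1 <= INR N) by (apply (le_INR 1); lia).
assert (Hw := weight_ge s (INR N ^ 2) ltac:(nra)).
assert (Hpow : Rpower (INR N ^ 2) s = Rpower (INR N) s ^ 2).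
{ simpl. rewrite !Rmult_1_r. symmetry. apply Rpower_mult_distr; lra. }
rewrite Hpow in Hw. assert (H2 := Rpower_pos 2 (- Rabs s)).
set (m := Cmod (a (Z.of_nat N))) in *. set (X := Rpower (INR N) s) in *.
assert (Hsq : r ^ 2 <= (m * X) ^ 2) by (apply pow_incr; lra).
apply Rle_trans with (Rpower 2 (- Rabs s) * X ^ 2 * m ^ 2).
- rewrite Rmult_assoc. apply Rmult_le_compat_l; [lra|]. lra.
- apply Rmult_le_compat_r; [apply pow2_ge_0 | exact Hw].
Qed.

(* At time [t = PI / (N (c - c'))] the two waves have opposite phases at frequency
   N, so the difference of the [N]-th coefficients becomes the sum. *)
Lemma opposite_phases (s kappa : R) (N : nat) (D D' D'' c c' t : R) (f g : R -> C) :
  s <= 1 -> 0 < kappa -> 0 <= D -> 0 <= D' -> 0 <= D'' ->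
  oscillating_profile N D f -> oscillating_profile N D' g ->
  oscillating_profile N D'' (profile_minus f g) ->
  8 * D'' * Rpower (INR N) s <= kappa ->
  kappa <= Cmod (fourier f (Z.of_nat N)) * Rpower (INR N) s ->
  INR N * (c - c') * t = PI ->
  sqrt (Rpower 2 (- Rabs s)) * kappa <=
    Hs_norm s (Csub (fourier (wave c f t)) (fourier (wave c' g t))).
Proof.
intros Hs Hkappa HD HD' HD'' Hf Hg Hfg Hsmall Hlarge Ht.
assert (HN : (0 < N)%nat) by apply Hf.
set (h := profile_minus (wave c f t) (wave c' g t)).
assert (Hwf := oscillating_profile_wave N D c t f Hf).
assert (Hwg := oscillating_profile_wave N D' c' t g Hg).
assert (Hh : oscillating_profile N (D + D') h) by now apply oscillating_profile_minus.
replace (Csub (fourier (wave c f t)) (fourier (wave c' g t))) with (fourier h).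
2:{ apply functional_extensionality. intros k.
    exact (fourier_profile_minus N D D' _ _ k Hwf Hwg). }
apply (Hs_norm_ge_mode s N); [exact HN | | lra |].
{ apply (Hs_norm_oscillating s N (D + D')); [exact Hs | lra | exact Hh]. }
unfold h. rewrite (fourier_profile_minus N D D' _ _ _ Hwf Hwg).
rewrite (fourier_wave N D c t f _ Hf), (fourier_wave N D' c' t g _ Hg).
rewrite <- INR_IZR_INZ.
set (th := INR N * - (c * t)).
replace (INR N * - (c' * t)) with (th + PI) by (rewrite <- Ht; unfold th; ring).
rewrite neg_cos, neg_sin.
assert (Hdiff := fourier_profile_minus N D D' f g (Z.of_nat N) Hf Hg).
set (F := fourier f (Z.of_nat N)) in *. set (G := fourier g (Z.of_nat N)) in *.
replace ((cos th, sin th) * F - (- cos th, - sin th)%R * G)%C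
  with ((cos th, sin th) * (F + F - (F - G)))%C by (apply injective_projections; simpl; ring).
assert (Hunit : Cmod (cos th, sin th) = 1).
{ assert (H := sin2_cos2 th). unfold Rsqr in H. unfold Cmod. simpl.
  rewrite !Rmult_1_r, Rplus_comm, H. apply sqrt_1. }
rewrite Cmod_mult, Hunit, Rmult_1_l.
assert (Hdec := fourier_decay N D'' _ Hfg (Z.of_nat N) ltac:(lia)).
rewrite Hdiff, <- INR_IZR_INZ in Hdec.
assert (HN' : 0 < INR N) by now apply lt_0_INR.
replace (8 * D'' ^ 2 * INR N ^ 4 / INR N ^ 4) with (8 * D'' ^ 2) in Hdec by (field; lra).
assert (HFG : Cmod (F - G) <= 8 * D'').
{ assert (H := Cmod_ge_0 (F - G)). nra. }
assert (Htri : Cmod (F + F) <= Cmod (F + F - (F - G)) + Cmod (F - G)).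
{ replace (F + F)%C with ((F + F - (F - G)) + (F - G))%C at 1 by ring. apply Cmod_triangle. }
assert (HFF : (Cmod (F + F) = 2 * Cmod F)%R).
{ replace (F + F)%C with (RtoC 2 * F)%C by (apply injective_projections; simpl; ring).
  rewrite Cmod_mult, Cmod_R, Rabs_pos_eq by lra. reflexivity. }
assert (HX := Rpower_pos (INR N) s). nra.
Qed.

Lemma ill_posed_of_decoherence (E : equation) (s rho kappa : R) :
  s <= 1 -> 0 < rho -> 0 < kappa ->
  (forall delta T, 0 < delta -> 0 < T ->
    exists (N : nat) (f g : R -> C) (c c' D D' D'' : R),
      (0 <= D /\ 0 <= D' /\ 0 <= D'') /\
      oscillating_profile N D f /\ oscillating_profile N D' g /\
      oscillating_profile N D'' (profile_minus f g) /\
      solution_map E f (wave c f) /\ solution_map E g (wave c' g) /\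
      Cmod (fourier f 0) + 8 * D * Rpower (INR N) s < rho /\
      Cmod (fourier g 0) + 8 * D' * Rpower (INR N) s < rho /\
      Cmod (fourier (profile_minus f g) 0) + 8 * D'' * Rpower (INR N) s < delta /\
      kappa <= Cmod (fourier f (Z.of_nat N)) * Rpower (INR N) s /\
      PI < INR N * Rabs (c - c') * T) ->
  ill_posed E s.
Proof.
intros Hs Hrho Hkappa Hwaves Hwp.
destruct (Hwp rho Hrho) as (T & HT & Phi & (_ & Hunif & Hext) & _).
set (eps := sqrt (Rpower 2 (- Rabs s)) * kappa).
assert (Heps : 0 < eps) by (apply Rmult_lt_0_compat; [apply sqrt_lt_R0, Rpower_pos | exact Hkappa]).
destruct (Hunif eps Heps) as (delta & Hdelta & Hcont).
destruct (Hwaves (Rmin delta kappa) T) as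
  (N & f & g & c & c' & D & D' & D'' & (HD & HD' & HD'') & Hf & Hg & Hfg & Sf & Sg & Bf & Bg & Bfg & Hlarge & Htime);
  [now apply Rmin_glb_lt | exact HT |].
assert (Hmin1 := Rmin_l delta kappa). assert (Hmin2 := Rmin_r delta kappa).
assert (Hball : forall u c0 D0, 0 <= D0 -> oscillating_profile N D0 u -> solution_map E u (wave c0 u) ->
  Cmod (fourier u 0) + 8 * D0 * Rpower (INR N) s < rho -> Hs_ball E s rho (fourier u)).
{ intros u c0 D0 HD0 Hu (_ & _ & Hreal & _ & Hu0) Bu. split.
  - apply (phase_space_profile E s N D0); try assumption.
    intros HE x. rewrite <- Hu0. now apply Hreal.
  - apply Rle_lt_trans with (2 := Bu). now apply Hs_norm_oscillating. }
assert (Ballf := Hball f c D HD Hf Sf Bf). assert (Ballg := Hball g c' D' HD' Hg Sg Bg).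
assert (Hclose : Hs_norm s (Csub (fourier f) (fourier g)) < delta).
{ replace (Csub (fourier f) (fourier g)) with (fourier (profile_minus f g)).
  - apply Rle_lt_trans with (1 := proj2 (Hs_norm_oscillating s N D'' _ Hs HD'' Hfg)). lra.
  - apply functional_extensionality. intros k. exact (fourier_profile_minus N D D' f g k Hf Hg). }
specialize (Hcont _ _ Ballf Ballg Hclose).
assert (HN : 0 < INR N) by (apply lt_0_INR, Hf).
assert (HPI := PI_RGT_0).
assert (Hcc : c - c' <> 0).
{ intros H. rewrite H, Rabs_R0 in Htime. lra. }
set (t := PI / (INR N * (c - c'))).
assert (Ht : - T < t < T).
{ apply and_comm, Rabs_def2. unfold t, Rdiv.
  rewrite Rabs_mult, Rabs_inv, Rabs_mult, (Rabs_pos_eq PI), (Rabs_pos_eq (INR N)) by lra.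
  assert (Hpos : 0 < INR N * Rabs (c - c')) by (apply Rmult_lt_0_compat; [exact HN | now apply Rabs_pos_lt]).
  apply Rlt_div_l; [exact Hpos|]. lra. }
assert (Hlower := opposite_phases s kappa N D D' D'' c c' t f g Hs Hkappa HD HD' HD'' Hf Hg Hfg).
assert (Hc0 := Cmod_ge_0 (fourier (profile_minus f g) 0)).
specialize (Hlower ltac:(lra) Hlarge ltac:(unfold t; field; lra)).
fold eps in Hlower. apply (Rlt_irrefl eps). apply Rle_lt_trans with (1 := Hlower).
change (Rbar_lt (Hs_norm s (Csub (fourier (wave c f t)) (fourier (wave c' g t)))) eps).
eapply Rbar_le_lt_trans; [|exact Hcont].
apply (proj1 (Lub_Rbar_correct _)). exists t. split; [exact Ht|].
f_equal. apply functional_extensionality. intros k. unfold Csub.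
now rewrite (Hext f _ Sf Ballf t Ht), (Hext g _ Sg Ballg t Ht).
Qed.

(** * The Jacobi amplitude *)

Section Inverse.

Context (F w : R -> R).
Hypothesis HF : forall x, is_derive F x (w x).
Hypothesis Hw : forall x, 1 <= w x.
Hypothesis Hwc : forall x, continuous w x.

Lemma mean_value (x y : R) :
  exists z, Rmin x y <= z <= Rmax x y /\ F y - F x = w z * (y - x).
Proof.
apply MVT_gen; intros z _; [apply HF|].
apply continuity_pt_filterlim, (ex_derive_continuous F). eexists; apply HF.
Qed.

Lemma expanding (x y : R) : Rabs (y - x) <= Rabs (F y - F x).
Proof.
destruct (mean_value x y) as (z & _ & ->). rewrite Rabs_mult.
assert (H := Hw z). rewrite (Rabs_pos_eq (w z)) by lra.
assert (H' := Rabs_pos (y - x)). nra.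
Qed.

Lemma right_inverse_exists : exists G, forall y, F (G y) = y.
Proof.
assert (Hsurj : forall y, {x | F x = y}).
{ intros y. set (a := Rabs (y - F 0)).
  assert (Ha : 0 <= a) by apply Rabs_pos.
  assert (Hay : - a <= y - F 0 <= a) by apply Rabs_le_between, Rle_refl.
  assert (Hr : F 0 + a <= F a).
  { destruct (mean_value 0 a) as (z & _ & H). assert (H1 := Hw z). nra. }
  assert (Hl : F (- a) <= F 0 - a).
  { destruct (mean_value (- a) 0) as (z & _ & H). assert (H1 := Hw z). nra. }
  destruct (IVT_gen F (- a) a y) as (x & _ & Hx).
  - intros x. apply continuity_pt_filterlim, (ex_derive_continuous F). eexists; apply HF.
  - rewrite Rmin_left, Rmax_right by lra. lra.
  - now exists x. }
exists (fun y => proj1_sig (Hsurj y)). intros y. exact (proj2_sig (Hsurj y)).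
Qed.

Lemma is_derive_right_inverse (G : R -> R) (y : R) :
  (forall y, F (G y) = y) -> is_derive G y (/ w (G y)).
Proof.
intros HG. apply is_derive_Reals. intros eps Heps.
assert (Hcont : continuity_pt (fun x => / w x) (G y)).
{ apply continuity_pt_inv; [apply continuity_pt_filterlim, Hwc|].
  assert (H := Hw (G y)). lra. }
destruct (Hcont eps Heps) as (delta & Hdelta & Hclose).
exists (mkposreal delta Hdelta). intros h Hh0 Hh. simpl in Hh.
destruct (mean_value (G y) (G (y + h))) as (z & Hz & Hmv). rewrite !HG in Hmv.
assert (Hwz := Hw z).
replace ((G (y + h) - G y) / h) with (/ w z).
2:{ replace h with (w z * (G (y + h) - G y)) at 2 by lra. field.
    split; [|lra]. intros H0. apply Hh0. rewrite H0 in Hmv. lra. }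
assert (Hlip := expanding (G y) (G (y + h))). rewrite !HG in Hlip.
replace (y + h - y) with h in Hlip by ring.
assert (Hzy : Rabs (z - G y) <= Rabs (G (y + h) - G y)).
{ unfold Rmin, Rmax in Hz. unfold Rabs.
  destruct (Rle_dec (G y) (G (y + h))), (Rcase_abs (z - G y)), (Rcase_abs (G (y + h) - G y)); lra. }
destruct (Req_dec z (G y)) as [->|Hne].
- rewrite Rminus_diag, Rabs_R0. exact Heps.
- apply (Hclose z). split; [split; [exact I | now apply not_eq_sym]|].
  unfold dist; simpl; unfold Rdist. lra.
Qed.

End Inverse.

Definition elliptic_weight (m x : R) : R := / sqrt (1 - m * sin x ^ 2).

(* [mean_weight m] is [2 K / PI] for the complete elliptic integral [K] of
   parameter [m]. *)
Definition mean_weight (m : R) : R := / PI * RInt (elliptic_weight m) 0 PI.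

Lemma sin_sqr_bounds (x : R) : 0 <= sin x ^ 2 <= 1.
Proof. assert (H := SIN_bound x). nra. Qed.

Section Weight.

Context (m : R).
Hypothesis Hm : 0 <= m <= 1 / 2.

Lemma radicand_bounds (x : R) : 1 - m <= 1 - m * sin x ^ 2 <= 1.
Proof. assert (H := sin_sqr_bounds x). nra. Qed.

Lemma radical_bounds (x : R) : 1 - m <= sqrt (1 - m * sin x ^ 2) <= 1.
Proof.
assert (H := radicand_bounds x). split.
- rewrite <- (sqrt_pow2 (1 - m)) by lra.
  apply sqrt_le_1_alt. apply Rle_trans with (1 - m); [nra | lra].
- rewrite <- sqrt_1 at 2. apply sqrt_le_1_alt. lra.
Qed.

Lemma elliptic_weight_bounds (x : R) : 1 <= elliptic_weight m x <= 1 + 2 * m.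
Proof.
assert (H := radical_bounds x). unfold elliptic_weight. split.
- rewrite <- Rinv_1 at 1. apply Rinv_le_contravar; lra.
- apply Rle_trans with (/ (1 - m)); [apply Rinv_le_contravar; lra|].
  apply (Rmult_le_reg_r (1 - m)); [lra|]. rewrite Rinv_l by lra. nra.
Qed.

Lemma elliptic_weight_continuous (x : R) : continuous (elliptic_weight m) x.
Proof.
apply (ex_derive_continuous (elliptic_weight m)). unfold elliptic_weight.
assert (H := radicand_bounds x). assert (H' := radical_bounds x).
auto_derive. unfold Rminus in *. simpl in *. repeat split; try apply Rgt_not_eq; lra.
Qed.

Lemma ex_RInt_elliptic_weight (a b : R) : ex_RInt (elliptic_weight m) a b.
Proof.
apply (ex_RInt_continuous (V := R_CompleteNormedModule)). intros x _.
apply elliptic_weight_continuous.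
Qed.

Lemma mean_weight_bounds : 1 <= mean_weight m <= 1 + 2 * m.
Proof.
assert (HPI := PI_RGT_0).
assert (Hc : forall c, RInt (fun _ => c) 0 PI = PI * c).
{ intros c. rewrite RInt_const. unfold scal; simpl; unfold mult; simpl. ring. }
assert (H1 : RInt (fun _ => 1) 0 PI <= RInt (elliptic_weight m) 0 PI).
{ apply RInt_le; [lra | apply ex_RInt_const | apply ex_RInt_elliptic_weight |].
  intros x _. apply elliptic_weight_bounds. }
assert (H2 : RInt (elliptic_weight m) 0 PI <= RInt (fun _ => 1 + 2 * m) 0 PI).
{ apply RInt_le; [lra | apply ex_RInt_elliptic_weight | apply ex_RInt_const |].
  intros x _. apply elliptic_weight_bounds. }
rewrite Hc in H1, H2. unfold mean_weight.
split; apply (Rmult_le_reg_l PI); try lra; rewrite <- Rmult_assoc, Rinv_r; lra.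
Qed.

End Weight.

Lemma mean_weight_monotone (m m' : R) :
  0 <= m -> m <= m' -> m' <= 1 / 2 -> mean_weight m <= mean_weight m'.
Proof.
intros Hm Hmm Hm'. assert (HPI := PI_RGT_0).
apply Rmult_le_compat_l; [left; apply Rinv_0_lt_compat; lra|].
apply RInt_le; [lra | apply ex_RInt_elliptic_weight; lra | apply ex_RInt_elliptic_weight; lra |].
intros x _. apply Rinv_le_contravar.
- assert (H := radical_bounds m' ltac:(lra) x). lra.
- apply sqrt_le_1_alt. assert (H := sin_sqr_bounds x). nra.
Qed.

(* [phi x = am (2 K x / PI)], the Jacobi amplitude rescaled so that
   [phi (x + PI) = phi x + PI]. *)
Definition amplitude (m : R) (phi : R -> R) : Prop :=
  (forall x, is_derive phi x (mean_weight m * sqrt (1 - m * sin (phi x) ^ 2))) /\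
  (forall x, phi (x + PI) = phi x + PI) /\
  (forall x, Rabs (phi x - x) <= 8 * m).

Lemma quasiperiodic_bound (psi : R -> R) (C : R) :
  (forall x, psi (x + PI) = psi x) -> (forall x, 0 <= x <= PI -> Rabs (psi x) <= C) ->
  forall x, Rabs (psi x) <= C.
Proof.
intros Hper HC. assert (HPI := PI_RGT_0).
assert (Hnat : forall n x, psi (x + INR n * PI) = psi x).
{ intros n x. now apply periodic_iter. }
assert (Hpos : forall x, 0 <= x -> Rabs (psi x) <= C).
{ intros x Hx. destruct (nfloor_ex (x / PI)) as (n & Hn1 & Hn2).
  { apply Rmult_le_pos; [exact Hx | left; now apply Rinv_0_lt_compat]. }
  replace x with (x - INR n * PI + INR n * PI) by ring. rewrite Hnat. apply HC.
  apply Rle_div_r in Hn1; [|lra]. apply Rlt_div_l in Hn2; [|lra]. lra. }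
intros x. destruct (Rle_dec 0 x) as [Hx|Hx]; [now apply Hpos|].
destruct (nfloor_ex (- x / PI)) as (n & Hn1 & Hn2).
{ apply Rmult_le_pos; [lra | left; now apply Rinv_0_lt_compat]. }
rewrite <- (Hnat (S n) x). apply Hpos. rewrite S_INR.
apply Rlt_div_l in Hn2; lra.
Qed.

Lemma sin_sqr_plus_PI (x : R) : sin (x + PI) ^ 2 = sin x ^ 2.
Proof. rewrite neg_sin. ring. Qed.

Lemma amplitude_exists (m : R) : 0 <= m <= 1 / 2 -> exists phi, amplitude m phi.
Proof.
intros Hm. assert (HPI := PI_RGT_0).
set (w := elliptic_weight m). set (F := (fun x => RInt w 0 x) : R -> R). set (B := mean_weight m).
assert (Hw1 : forall x, 1 <= w x) by (intros x; now apply elliptic_weight_bounds).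
assert (Hwc : forall x, continuous w x) by (intros x; now apply elliptic_weight_continuous).
assert (HF : forall x, is_derive F x (w x)).
{ intros x. apply (is_derive_RInt (V := R_NormedModule) w F 0); [|apply Hwc].
  apply filter_forall. intros b. apply (RInt_correct (V := R_CompleteNormedModule)).
  now apply ex_RInt_elliptic_weight. }
assert (HF0 : F 0 = 0) by (apply (RInt_point (V := R_CompleteNormedModule))).
assert (HFPI : F PI = PI * B) 
  by (unfold B, mean_weight; rewrite <- Rmult_assoc, Rinv_r, Rmult_1_l by lra; reflexivity).
assert (Hshift : forall x, F (x + PI) = F x + PI * B).
{ intros x.
  destruct (MVT_gen (fun y => F (y + PI) - F y) 0 x (fun _ => 0)) as (z & _ & Hz).
  - intros y _. replace 0 with (minus (scal 1 (w (y + PI))) (w y)).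
    + apply (is_derive_minus (V := R_NormedModule)); [|apply HF].
      apply (is_derive_comp F (fun y => y + PI)); [apply HF|]. auto_derive; auto; ring.
    + unfold w, elliptic_weight. rewrite sin_sqr_plus_PI.
      unfold minus, plus, opp, scal; simpl. unfold mult; simpl. ring.
  - intros y _. apply continuity_pt_minus.
    + apply (continuity_pt_comp (fun y => y + PI) F).
      * apply continuity_pt_filterlim, (ex_derive_continuous (fun y => y + PI)). auto_derive. auto.
      * apply continuity_pt_filterlim, (ex_derive_continuous F). eexists; apply HF.
    + apply continuity_pt_filterlim, (ex_derive_continuous F). eexists; apply HF.
  - rewrite Rplus_0_l in Hz. lra. }
destruct (right_inverse_exists F w HF Hw1) as (G & HG).
assert (Hinj : forall x y, F x = F y -> x = y).
{ intros x y Hxy. assert (H := expanding F w HF Hw1 x y).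
  rewrite Hxy, Rminus_diag, Rabs_R0 in H. assert (H' := Rabs_pos (y - x)).
  assert (H0 : Rabs (y - x) = 0) by lra. apply Rabs_eq_0 in H0. lra. }
assert (HB := mean_weight_bounds m Hm). fold B in HB.
set (phi := fun x => G (B * x)).
assert (Hphi : forall x, is_derive phi x (B * sqrt (1 - m * sin (phi x) ^ 2))).
{ intros x.
  assert (H := is_derive_right_inverse F w HF Hw1 Hwc G (B * x) HG).
  unfold w, elliptic_weight in H. rewrite Rinv_inv in H.
  assert (HBx : is_derive (fun y => B * y) x B) by (auto_derive; [exact I | ring]).
  exact (is_derive_comp G (fun y => B * y) x _ B H HBx). }
assert (Hper : forall x, phi (x + PI) = phi x + PI).
{ intros x. apply Hinj. unfold phi. rewrite Hshift, !HG. ring. }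
exists phi. split; [exact Hphi | split; [exact Hper|]].
apply quasiperiodic_bound.
- intros x. rewrite Hper. ring.
- intros x Hx. assert (Hphi0 : phi 0 = 0).
  { apply Hinj. unfold phi. rewrite HG, HF0. ring. }
  destruct (MVT_gen phi 0 x (fun x => B * sqrt (1 - m * sin (phi x) ^ 2))) as (z & _ & Hz).
  { intros y _. apply Hphi. }
  { intros y _. apply continuity_pt_filterlim, (ex_derive_continuous phi). eexists; apply Hphi. }
  rewrite Hphi0, !Rminus_0_r in Hz. rewrite Hz.
  assert (Hr := radical_bounds m Hm (phi z)). set (r := sqrt (1 - m * sin (phi z) ^ 2)) in *.
  assert (Hslope : - (2 * m) <= B * r - 1 <= 2 * m) by nra.
  assert (H4 := PI_4). apply Rabs_le. replace (B * r * x - x) with ((B * r - 1) * x) by ring. nra.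
Qed.

(** * The Jacobi functions sn and sn^2 *)

Inductive generated (G : (R -> R) -> Prop) : (R -> R) -> Prop :=
| generated_base f : G f -> generated G f
| generated_const c : generated G (fun _ => c)
| generated_plus f g : generated G f -> generated G g -> generated G (fun x => f x + g x)
| generated_mult f g : generated G f -> generated G g -> generated G (fun x => f x * g x).

Lemma generated_smooth (G : (R -> R) -> Prop) :
  (forall f, G f -> exists f', generated G f' /\ forall x, is_derive f x (f' x)) ->
  forall f, generated G f -> smooth f.
Proof.
intros HG.
assert (Hder : forall f, generated G f ->
  exists f', generated G f' /\ forall x, is_derive f x (f' x)).
{ intros f Hf. induction Hf as [f Hf|c|f g Hf (f' & Hf' & Hfd) Hg (g' & Hg' & Hgd)
                                |f g Hf (f' & Hf' & Hfd) Hg (g' & Hg' & Hgd)].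
  - now apply HG.
  - exists (fun _ => 0). split; [apply generated_const|]. intros x. apply (is_derive_const (V := R_NormedModule)).
  - exists (fun x => f' x + g' x). split; [now apply generated_plus|].
    intros x. now apply (is_derive_plus (V := R_NormedModule)).
  - exists (fun x => f' x * g x + f x * g' x). split.
    + apply generated_plus; now apply generated_mult.
    + intros x. apply (is_derive_mult f g x (f' x) (g' x)); auto using Rmult_comm. }
intros f Hf.
assert (Hn : forall n, generated G (Derive_n f n)).
{ induction n as [|n IH]; [exact Hf|]. destruct (Hder _ IH) as (g & Hg & Hd).
  replace (Derive_n f (S n)) with g; [exact Hg|].
  apply functional_extensionality. intros x. symmetry. apply is_derive_unique, Hd. }
intros [|n] x; [exact I|]. destruct (Hder _ (Hn n)) as (g & _ & Hd). exists (g x). apply Hd.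
Qed.

Lemma smooth_sin_cos : smooth sin /\ smooth cos.
Proof.
assert (H : forall f, generated (fun f => f = sin \/ f = cos) f -> smooth f).
{ apply generated_smooth. intros f [->| ->].
  - exists cos. split; [now constructor; right|]. intros x. apply is_derive_sin.
  - exists (fun x => -1 * sin x). split.
    + apply (generated_mult _ (fun _ => -1) sin); [apply generated_const | constructor; now left].
    + intros x. replace (-1 * sin x) with (- sin x) by ring. apply is_derive_cos. }
split; apply H; constructor; [now left | now right].
Qed.

Definition scaled (a M b : R) (S : R -> R) (x : R) : R := a * S (M * x) - b.

Section Scaled.

Context (a M b : R) (S : R -> R).
Hypothesis HS : smooth S.

Lemma smooth_scaled : smooth (scaled a M b S).
Proof.
unfold scaled. apply smooth_minus; [|apply smooth_const].
intros n x. apply ex_derive_n_scal_l. now apply smooth_dilate.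
Qed.

Lemma Derive_n_scaled (n : nat) (x : R) :
  (0 < n)%nat -> Derive_n (scaled a M b S) n x = a * M ^ n * Derive_n S n (M * x).
Proof.
intros Hn. unfold scaled. rewrite Derive_n_smooth_minus.
- rewrite Derive_n_scal_l, Derive_n_comp_scal.
  + destruct n as [|n]; [lia|]. rewrite Derive_n_const. ring.
  + apply filter_forall. intros y k _. apply HS.
- intros k y. apply ex_derive_n_scal_l. now apply smooth_dilate.
- apply smooth_const.
Qed.

End Scaled.

Lemma Derive_n_chain (f f' : R -> R) (n : nat) (x l : R) :
  (forall x, Derive_n f n x = f' x) -> is_derive f' x l -> Derive_n f (S n) x = l.
Proof.
intros H Hl. simpl. rewrite (Derive_ext _ f') by exact H. now apply is_derive_unique.
Qed.

Section JacobiFunctions.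

Context (m : R) (phi : R -> R).
Hypothesis Hm : 0 <= m <= 1 / 2.
Hypothesis Hphi : amplitude m phi.

Let B := mean_weight m.
Let d (x : R) : R := B * sqrt (1 - m * sin (phi x) ^ 2).

Definition sn (x : R) : R := sin (phi x).
Definition sn2 (x : R) : R := sin (phi x) ^ 2.

Let Hd x : is_derive phi x (d x).
Proof. apply Hphi. Qed.

Let radicand_pos x : 0 < 1 - m * sin (phi x) ^ 2.
Proof. assert (H := radicand_bounds m Hm (phi x)). lra. Qed.

Let d_sqr x : d x ^ 2 = B ^ 2 * (1 - m * sin (phi x) ^ 2).
Proof.
unfold d. rewrite Rpow_mult_distr, pow2_sqrt; [reflexivity|].
left. apply radicand_pos.
Qed.

Let Hdd x : is_derive d x (- (B ^ 2 * m * (sin (phi x) * cos (phi x)))).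
Proof.
assert (H := Hd x). assert (H0 := radicand_pos x). assert (Hs := sqrt_lt_R0 _ H0).
unfold d at 1. auto_derive.
- simpl in H0. split; [eexists; exact H | split; [|exact I]]. unfold Rminus in H0. exact H0.
- replace (Derive (fun x0 : R => phi x0) x) with (d x)
    by (symmetry; exact (is_derive_unique phi x _ H)).
  unfold d.
  replace (1 + - (m * (sin (phi x) * (sin (phi x) * 1)))) with (1 - m * sin (phi x) ^ 2) by ring.
  field. lra.
Qed.

Let sin_sqr_cos x : cos (phi x) ^ 2 = 1 - sin (phi x) ^ 2.
Proof. assert (H := sin2_cos2 (phi x)). unfold Rsqr in H. lra. Qed.

Let D_sin x : is_derive (fun y => sin (phi y)) x (cos (phi x) * d x).
Proof.
assert (H := Hd x). auto_derive; [eexists; exact H|].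
replace (Derive (fun x0 : R => phi x0) x) with (d x)
  by (symmetry; exact (is_derive_unique phi x _ H)).
ring.
Qed.

Let D_cos x : is_derive (fun y => cos (phi y)) x (- (sin (phi x) * d x)).
Proof.
assert (H := Hd x). auto_derive; [eexists; exact H|].
replace (Derive (fun x0 : R => phi x0) x) with (d x)
  by (symmetry; exact (is_derive_unique phi x _ H)).
ring.
Qed.

Lemma smooth_sn : smooth sn /\ smooth sn2.
Proof.
set (G := fun f => f = (fun x => sin (phi x)) \/ f = (fun x => cos (phi x)) \/ f = d).
assert (HG : forall f, generated G f -> smooth f).
{ apply generated_smooth. intros f [->|[->| ->]].
  - exists (fun x => cos (phi x) * d x). split; [|exact D_sin].
    apply (generated_mult G (fun x => cos (phi x)) d); constructor; unfold G; auto.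
  - exists (fun x => -1 * (sin (phi x) * d x)). split.
    + apply (generated_mult G (fun _ => -1) (fun x => sin (phi x) * d x)); [apply generated_const|].
      apply (generated_mult G (fun x => sin (phi x)) d); constructor; unfold G; auto.
    + intros x. replace (-1 * (sin (phi x) * d x)) with (- (sin (phi x) * d x)) by ring. apply D_cos.
  - exists (fun x => - (B ^ 2 * m) * (sin (phi x) * cos (phi x))). split.
    + apply (generated_mult G (fun _ => - (B ^ 2 * m))); [apply generated_const|].
      apply (generated_mult G (fun x => sin (phi x)) (fun x => cos (phi x)));
        constructor; unfold G; auto.
    + intros x. rewrite <- Ropp_mult_distr_l. apply Hdd. }
assert (Hs : generated G (fun x => sin (phi x))) by (constructor; unfold G; auto).
split; apply HG; [exact Hs|].
apply (generated_mult G (fun x => sin (phi x)) (fun x => sin (phi x) * 1)); [exact Hs|].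
apply (generated_mult G (fun x => sin (phi x)) (fun _ => 1)); [exact Hs | apply generated_const].
Qed.

Lemma Derive_sn (x : R) : Derive_n sn 1 x = cos (phi x) * d x.
Proof. apply is_derive_unique, D_sin. Qed.

Lemma Derive2_sn (x : R) :
  Derive_n sn 2 x = - (B ^ 2 * sin (phi x) * (1 + m - 2 * m * sin (phi x) ^ 2)).
Proof.
apply (Derive_n_chain _ _ _ _ _ Derive_sn).
assert (H := is_derive_mult (fun x => cos (phi x)) d x _ _ (D_cos x) (Hdd x) Rmult_comm).
evar_last; [exact H|]. unfold plus, mult; simpl.
transitivity (- (sin (phi x) * d x ^ 2) - B ^ 2 * m * (sin (phi x) * cos (phi x) ^ 2)); [ring|].
rewrite d_sqr, sin_sqr_cos. ring.
Qed.

Lemma Derive3_sn (x : R) :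
  Derive_n sn 3 x = - (B ^ 2 * (1 + m - 6 * m * sn x ^ 2)) * Derive_n sn 1 x.
Proof.
rewrite Derive_sn. apply (Derive_n_chain _ _ _ _ _ Derive2_sn).
assert (H := D_sin x).
apply (is_derive_ext (fun y => - (B ^ 2 * sn y * (1 + m - 2 * m * sn y ^ 2)))); [reflexivity|].
auto_derive; [repeat apply conj; try exact I; eexists; exact H|].
change (Derive (fun x0 => sn x0) x) with (Derive_n sn 1 x). rewrite Derive_sn. ring.
Qed.

Lemma Derive_sn2 (x : R) : Derive_n sn2 1 x = 2 * sn x * Derive_n sn 1 x.
Proof.
assert (H := D_sin x). rewrite Derive_sn. apply is_derive_unique.
apply (is_derive_ext (fun y => sn y ^ 2)); [reflexivity|].
auto_derive; [repeat apply conj; try exact I; eexists; exact H|].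
change (Derive (fun x0 => sn x0) x) with (Derive_n sn 1 x). rewrite Derive_sn. ring.
Qed.

Lemma Derive2_sn2 (x : R) :
  Derive_n sn2 2 x = 2 * B ^ 2 * (1 - 2 * (1 + m) * sn2 x + 3 * m * sn2 x ^ 2).
Proof.
apply (Derive_n_chain _ _ _ _ _ Derive_sn2).
assert (H := D_sin x). assert (H1 := smooth_Derive_n sn 1 x (proj1 smooth_sn)).
auto_derive; [split; [eexists; exact H | split; [eexists; exact H1 | exact I]]|].
change (Derive (fun x0 => sn x0) x) with (Derive_n sn 1 x).
change (Derive (fun x0 => Derive (fun x1 => sn x1) x0) x) with (Derive_n sn 2 x).
rewrite Derive2_sn, Derive_sn.
change (sn2 x) with (sin (phi x) ^ 2). unfold sn.
transitivity (2 * (cos (phi x) ^ 2 * d x ^ 2)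
  + 2 * sin (phi x) * - (B ^ 2 * sin (phi x) * (1 + m - 2 * m * sin (phi x) ^ 2))); [ring|].
rewrite d_sqr, sin_sqr_cos. ring.
Qed.

Lemma Derive3_sn2 (x : R) :
  Derive_n sn2 3 x = 2 * B ^ 2 * (- 2 * (1 + m) + 6 * m * sn2 x) * Derive_n sn2 1 x.
Proof.
apply (Derive_n_chain _ _ _ _ _ Derive2_sn2).
assert (H := smooth_Derive_n sn2 0 x (proj2 smooth_sn)).
auto_derive; [repeat apply conj; try exact I; eexists; exact H|].
change (Derive (fun x0 => sn2 x0) x) with (Derive_n sn2 1 x). ring.
Qed.

End JacobiFunctions.

Lemma sin_lipschitz (x y : R) : Rabs (sin x - sin y) <= Rabs (x - y).
Proof.
destruct (MVT_gen sin y x cos) as (z & _ & ->).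
- intros z _. apply is_derive_sin.
- intros z _. apply continuity_sin.
- rewrite Rabs_mult. assert (H := Rabs_cos_le z). assert (H' := Rabs_pos (x - y)). nra.
Qed.

Section Approximation.

Context (m : R) (phi : R -> R).
Hypothesis Hm : 0 <= m <= 1 / 2.
Hypothesis Hphi : amplitude m phi.

Let B := mean_weight m.

Let HB : 1 <= B <= 1 + 2 * m.
Proof. now apply mean_weight_bounds. Qed.

Let sin_phi_close x : Rabs (sin (phi x) - sin x) <= 8 * m.
Proof. apply Rle_trans with (1 := sin_lipschitz _ _). apply Hphi. Qed.

Lemma sn_approx (x : R) : Rabs (B * sn phi x - sin x) <= 10 * m.
Proof.
assert (H := sin_phi_close x). apply Rabs_le_between in H. apply Rabs_le. unfold sn.
assert (H' := SIN_bound (phi x)). nra.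
Qed.

Lemma Derive2_sn_approx (x : R) : Rabs (B * Derive_n (sn phi) 2 x + sin x) <= 30 * m.
Proof.
rewrite (Derive2_sn m phi Hm Hphi). fold B.
assert (H := sin_phi_close x). apply Rabs_le_between in H.
assert (H' := SIN_bound (phi x)). assert (Hs := sin_sqr_bounds (phi x)).
set (u := sin (phi x)) in *. set (E := 1 + m - 2 * m * u ^ 2).
assert (HE : 1 - m <= E <= 1 + m) by (unfold E; nra).
assert (HB3 : 1 <= B ^ 3 <= 1 + 14 * m).
{ split.
  - apply (pow_R1_Rle B 3). lra.
  - apply Rle_trans with ((1 + 2 * m) ^ 3); [apply pow_incr; lra | nra]. }
assert (HBE : - m <= B ^ 3 * E - 1 <= 22 * m) by nra.
replace (B * - (B ^ 2 * u * E) + sin x) with (- ((B ^ 3 * E - 1) * u) - (u - sin x)) by ring.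
apply Rabs_le. assert (- (22 * m) <= (B ^ 3 * E - 1) * u <= 22 * m) by nra. lra.
Qed.

Lemma sn2_approx (x : R) : Rabs (2 * B ^ 2 * sn2 phi x - (1 - cos (2 * x))) <= 44 * m.
Proof.
assert (H := sin_phi_close x). apply Rabs_le_between in H. unfold sn2.
rewrite cos_2a_sin.
assert (H' := SIN_bound (phi x)). assert (Hx := SIN_bound x).
assert (Hs := sin_sqr_bounds (phi x)).
set (u := sin (phi x)) in *. set (v := sin x) in *.
assert (HB2 : 1 <= B ^ 2 <= 1 + 6 * m) by nra.
assert (Huv : - (16 * m) <= u ^ 2 - v ^ 2 <= 16 * m).
{ replace (u ^ 2 - v ^ 2) with ((u - v) * (u + v)) by ring. nra. }
apply Rabs_le.
replace (2 * B ^ 2 * u ^ 2 - (1 - (1 - 2 * v * v)))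
  with (2 * ((B ^ 2 - 1) * u ^ 2) + 2 * (u ^ 2 - v ^ 2)) by ring.
assert (0 <= (B ^ 2 - 1) * u ^ 2 <= 6 * m) by nra. lra.
Qed.

End Approximation.

Section Modes.

Context (k : Z).
Hypothesis Hk : k <> 0%Z.

Let HkR : IZR k <> 0.
Proof. now apply not_0_IZR. Qed.

Let sin_2PI : sin (IZR k * (2 * PI)) = 0.
Proof.
replace (2 * PI) with (0 + 2 * PI) by ring. rewrite sin_mode_period, Rmult_0_r. apply sin_0.
Qed.

Let sin_0' : sin (IZR k * 0) = 0.
Proof. rewrite Rmult_0_r. apply sin_0. Qed.

Let cos_2PI : cos (IZR k * (2 * PI)) = 1.
Proof.
replace (2 * PI) with (0 + 2 * PI) by ring. rewrite cos_mode_period, Rmult_0_r. apply cos_0.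
Qed.

Let cos_0' : cos (IZR k * 0) = 1.
Proof. rewrite Rmult_0_r. apply cos_0. Qed.

Lemma cos_coef_cos (a b : R) : cos_coef (fun x => a + b * cos (IZR k * x)) k = PI * b.
Proof.
unfold cos_coef.
rewrite (RInt_of_derive (fun x => a * sin (IZR k * x) / IZR k
  + b * (x / 2 + sin (IZR k * x) * cos (IZR k * x) / (2 * IZR k)))).
- rewrite sin_2PI, sin_0'. field. exact HkR.
- intros x. auto_derive; [exact I|].
  assert (H := sin2_cos2 (IZR k * x)). unfold Rsqr in H.
  transitivity (a * cos (IZR k * x) + b * ((sin (IZR k * x) * sin (IZR k * x)
    + cos (IZR k * x) * cos (IZR k * x)) / 2 + (cos (IZR k * x) * cos (IZR k * x)
    - sin (IZR k * x) * sin (IZR k * x)) / 2)); [rewrite H|]; field; exact HkR.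
- intros x. apply (ex_derive_continuous (fun x => (a + b * cos (IZR k * x)) * cos (IZR k * x))).
  auto_derive. exact I.
Qed.

Lemma sin_coef_sin (a b : R) : sin_coef (fun x => a + b * sin (IZR k * x)) k = PI * b.
Proof.
unfold sin_coef.
rewrite (RInt_of_derive (fun x => - (a * cos (IZR k * x) / IZR k)
  + b * (x / 2 - sin (IZR k * x) * cos (IZR k * x) / (2 * IZR k)))).
- rewrite sin_2PI, sin_0', cos_2PI, cos_0'. field. exact HkR.
- intros x. auto_derive; [exact I|].
  assert (H := sin2_cos2 (IZR k * x)). unfold Rsqr in H.
  transitivity (a * sin (IZR k * x) + b * ((sin (IZR k * x) * sin (IZR k * x)
    + cos (IZR k * x) * cos (IZR k * x)) / 2 - (cos (IZR k * x) * cos (IZR k * x)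
    - sin (IZR k * x) * sin (IZR k * x)) / 2)); [rewrite H|]; field; exact HkR.
- intros x. apply (ex_derive_continuous (fun x => (a + b * sin (IZR k * x)) * sin (IZR k * x))).
  auto_derive. exact I.
Qed.

End Modes.

(** * Plane waves and NLS *)

Lemma oscillating_real_profile (N : nat) (D : R) (p : R -> R) :
  (0 < N)%nat -> 0 <= D -> oscillating N D p -> oscillating_profile N D (real_profile p).
Proof.
intros HN HD Hp. split; [exact HN | split; [exact Hp | now apply oscillating_0]].
Qed.

Lemma fourier_real_profile (N : nat) (D : R) (p : R -> R) (k : Z) :
  (0 < N)%nat -> 0 <= D -> oscillating N D p ->
  fourier (real_profile p) k = (/ (2 * PI) * cos_coef p k, - (/ (2 * PI) * sin_coef p k)).
Proof.
intros HN HD Hp.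
rewrite (fourier_profile N D) by now apply oscillating_real_profile.
change (fun x => Re (real_profile p x)) with p.
change (fun x => Im (real_profile p x)) with (fun _ : R => 0).
destruct (coef_0 k) as [H3 H4]. rewrite H3, H4. apply injective_projections; simpl; ring.
Qed.

Lemma sin_coef_0 (p : R -> R) : (forall x, continuous p x) -> sin_coef p 0 = 0.
Proof. intros Hp. assert (H := sin_coef_opp p 0 Hp). simpl in H. lra. Qed.

Lemma cos_coef_antiperiodic (p : R -> R) (h : R) :
  (forall x, continuous p x) -> (forall x, p (x + 2 * PI) = p x) ->
  (forall x, p (x + h) = - p x) -> cos_coef p 0 = 0.
Proof.
intros Hp Hper Hanti.
assert (H := cos_coef_translate p h 0 Hp Hper). rewrite Rmult_0_l, cos_0, sin_0 in H.
assert (Hopp : cos_coef (fun x => p (x + h)) 0 = - cos_coef p 0).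
{ unfold cos_coef. rewrite <- (RInt_opp (V := R_CompleteNormedModule)) by now apply ex_RInt_mul_cos.
  apply RInt_ext. intros x _. rewrite Hanti. unfold opp; simpl. ring. }
lra.
Qed.

Lemma fourier_mode_ge (N : nat) (D a b r : R) (p : R -> R) :
  (0 < N)%nat -> 0 <= D -> oscillating N D p -> 0 <= b ->
  (forall x, Rabs (p x - (a + b * sin (INR N * x))) <= r) \/
  (forall x, Rabs (p x - (a + - b * cos (INR N * x))) <= r) ->
  b / 2 - r <= Cmod (fourier (real_profile p) (Z.of_nat N)).
Proof.
intros HN HD Hp Hb Happrox. rewrite (fourier_real_profile N D p _ HN HD Hp).
assert (HPI := PI_RGT_0).
assert (Hcont : forall x, continuous p x) by (intros x; apply smooth_continuous, Hp).
set (z := (_, _)).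
assert (Hmode : forall y : R, Rabs y <= 2 * PI * r -> b / 2 - r <= Rabs (/ (2 * PI) * (y + PI * b))).
{ intros y Hy. apply Rabs_le_between in Hy. apply Rle_trans with (2 := Rle_abs _).
  apply (Rmult_le_reg_l (2 * PI)); [lra|]. rewrite <- Rmult_assoc, Rinv_r by lra. lra. }
assert (Hk : Z.of_nat N <> 0%Z) by lia.
rewrite INR_IZR_INZ in Happrox. destruct Happrox as [H|H].
- apply Rle_trans with (2 := Rmax_Cmod z). apply Rle_trans with (2 := Rmax_r _ _).
  unfold z; simpl. rewrite Rabs_Ropp.
  set (q := fun x => a + b * sin (IZR (Z.of_nat N) * x)) in *.
  assert (Hq : forall x, continuous q x).
  { intros x. apply (ex_derive_continuous q). unfold q. auto_derive. exact I. }
  replace (sin_coef p (Z.of_nat N))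
    with (sin_coef (fun x => p x - q x) (Z.of_nat N) + PI * b).
  + apply Hmode, sin_coef_le_sup; [|exact H].
    intros x. now apply (continuous_minus (V := R_NormedModule)).
  + rewrite sin_coef_minus by assumption. unfold q. rewrite sin_coef_sin by exact Hk. ring.
- apply Rle_trans with (2 := Rmax_Cmod z). apply Rle_trans with (2 := Rmax_l _ _).
  unfold z; simpl.
  set (q := fun x => a + - b * cos (IZR (Z.of_nat N) * x)) in *.
  assert (Hq : forall x, continuous q x).
  { intros x. apply (ex_derive_continuous q). unfold q. auto_derive. exact I. }
  replace (cos_coef p (Z.of_nat N))
    with (- (- cos_coef (fun x => p x - q x) (Z.of_nat N) + PI * b)).
  + rewrite <- Ropp_mult_distr_r, Rabs_Ropp. apply Hmode. rewrite Rabs_Ropp.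
    apply cos_coef_le_sup; [|exact H].
    intros x. now apply (continuous_minus (V := R_NormedModule)).
  + rewrite cos_coef_minus by assumption. unfold q. rewrite cos_coef_cos by exact Hk. ring.
Qed.

Lemma Rpower_small (a eps : R) :
  a < 0 -> 0 < eps -> exists n0, forall n, (n0 <= n)%nat -> Rpower (INR n) a < eps.
Proof.
intros Ha Heps. destruct (nfloor_ex (Rpower eps (/ a))) as (n0 & _ & Hn0).
{ left. apply Rpower_pos. }
exists (S n0). intros n Hn. apply le_INR in Hn. rewrite S_INR in Hn.
assert (Hp := Rpower_pos eps (/ a)).
replace eps with (Rpower (Rpower eps (/ a)) a).
2:{ rewrite Rpower_mult, Rinv_l, Rpower_1; lra. }
unfold Rpower at 1 2. apply exp_increasing.
assert (Hln : ln (Rpower eps (/ a)) < ln (INR n)) by (apply ln_increasing; lra).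
nra.
Qed.

Lemma Rpower_small2 (a a' eps eps' : R) :
  a < 0 -> a' < 0 -> 0 < eps -> 0 < eps' ->
  exists n, (0 < n)%nat /\ Rpower (INR n) a < eps /\ Rpower (INR n) a' < eps'.
Proof.
intros Ha Ha' Heps Heps'.
destruct (Rpower_small a eps Ha Heps) as (n & Hn).
destruct (Rpower_small a' eps' Ha' Heps') as (n' & Hn').
exists (S (n + n')). split; [lia|]. split; [apply Hn | apply Hn']; lia.
Qed.

Section PlaneWave.

Context (N : nat) (A : R).
Hypothesis HN : (0 < N)%nat.
Hypothesis HA : 0 <= A.

Definition plane_wave (x : R) : C := (scaled A (INR N) 0 cos x, scaled A (INR N) 0 sin x).

Let HN' : 0 < INR N.
Proof. now apply lt_0_INR. Qed.

Let D_cos x : Derive_n cos 1 x = - sin x.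
Proof. apply is_derive_unique, is_derive_cos. Qed.

Let D_sin x : Derive_n sin 1 x = cos x.
Proof. apply is_derive_unique, is_derive_sin. Qed.

Let D2_cos x : Derive_n cos 2 x = - cos x.
Proof.
apply (Derive_n_chain _ _ _ _ _ D_cos).
apply (is_derive_opp (V := R_NormedModule)), is_derive_sin.
Qed.

Let D2_sin x : Derive_n sin 2 x = - sin x.
Proof. apply (Derive_n_chain _ _ _ _ _ D_sin), is_derive_cos. Qed.

Lemma oscillating_trig (S : R -> R) :
  smooth S -> (forall x, S (x + 2 * PI) = S x) -> (forall x, Rabs (Derive_n S 2 x) <= 1) ->
  oscillating N A (scaled A (INR N) 0 S).
Proof.
intros HS Hper H2. split; [now apply smooth_scaled | split].
- intros x. unfold scaled. replace (INR N * (x + 2 * PI / INR N)) with (INR N * x + 2 * PI)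
    by (field; lra). now rewrite Hper.
- intros x. rewrite Derive_n_scaled by (assumption || lia).
  rewrite Rabs_mult, Rabs_pos_eq by (apply Rmult_le_pos; [exact HA | apply pow2_ge_0]).
  assert (H := H2 (INR N * x)). assert (H0 : 0 <= A * INR N ^ 2) by (apply Rmult_le_pos; [exact HA | apply pow2_ge_0]).
  nra.
Qed.

Lemma plane_wave_oscillating : oscillating_profile N A plane_wave.
Proof.
split; [exact HN | split].
- apply (oscillating_trig cos (proj2 smooth_sin_cos)).
  + intros x. replace (x + 2 * PI) with (x + 2 * INR 1 * PI) by (simpl; ring). apply cos_period.
  + intros x. rewrite D2_cos, Rabs_Ropp. apply Rabs_cos_le.
- apply (oscillating_trig sin (proj1 smooth_sin_cos)).
  + intros x. replace (x + 2 * PI) with (x + 2 * INR 1 * PI) by (simpl; ring). apply sin_period.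
  + intros x. rewrite D2_sin, Rabs_Ropp. apply Rabs_sin_le.
Qed.

Lemma plane_wave_solution :
  solution_map NLS plane_wave (wave (- (INR N ^ 2 + A ^ 2) / INR N) plane_wave).
Proof.
destruct smooth_sin_cos as [Hsin Hcos].
apply NLS_wave; [apply (oscillating_profile_smooth N A), plane_wave_oscillating | |];
  intros x; simpl Re; simpl Im;
  change (fun y => scaled A (INR N) 0 ?S y) with (scaled A (INR N) 0 S);
  change (fun y => Re (plane_wave y)) with (scaled A (INR N) 0 cos);
  change (fun y => Im (plane_wave y)) with (scaled A (INR N) 0 sin);
  [change (Derive (scaled A (INR N) 0 sin) x) with (Derive_n (scaled A (INR N) 0 sin) 1 x)
  |change (Derive (scaled A (INR N) 0 cos) x) with (Derive_n (scaled A (INR N) 0 cos) 1 x)];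
  rewrite !Derive_n_scaled by (assumption || lia); unfold scaled;
  assert (H := sin2_cos2 (INR N * x)); unfold Rsqr in H.
- rewrite D2_cos, D_sin.
  transitivity (A ^ 2 * 1 * (A * cos (INR N * x))); [field; lra | rewrite <- H; ring].
- rewrite D2_sin, D_cos.
  transitivity (A ^ 2 * 1 * (A * sin (INR N * x))); [field; lra | rewrite <- H; ring].
Qed.

Lemma plane_wave_mean : fourier plane_wave 0 = 0.
Proof.
assert (Hosc := plane_wave_oscillating).
rewrite (fourier_profile N A) by exact Hosc.
destruct Hosc as (_ & HRe & HIm).
assert (Hc : forall x, continuous (scaled A (INR N) 0 cos) x) by (intros x; apply smooth_continuous, HRe).
assert (Hs : forall x, continuous (scaled A (INR N) 0 sin) x) by (intros x; apply smooth_continuous, HIm).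
change (fun y => Re (plane_wave y)) with (scaled A (INR N) 0 cos).
change (fun y => Im (plane_wave y)) with (scaled A (INR N) 0 sin).
rewrite !sin_coef_0 by assumption.
rewrite !(cos_coef_antiperiodic _ (PI / INR N));
  try assumption; try (now apply (oscillating_period N A)).
- apply injective_projections; simpl; ring.
- intros x. unfold scaled. replace (INR N * (x + PI / INR N)) with (INR N * x + PI) by (field; lra).
  rewrite neg_sin. ring.
- intros x. unfold scaled. replace (INR N * (x + PI / INR N)) with (INR N * x + PI) by (field; lra).
  rewrite neg_cos. ring.
Qed.

Lemma plane_wave_mode : A <= Cmod (fourier plane_wave (Z.of_nat N)).
Proof.
rewrite (fourier_profile N A) by exact plane_wave_oscillating.
change (fun y => Re (plane_wave y)) with (scaled A (INR N) 0 cos).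
change (fun y => Im (plane_wave y)) with (scaled A (INR N) 0 sin).
assert (HPI := PI_RGT_0).
assert (Hk : Z.of_nat N <> 0%Z) by lia.
apply Rle_trans with (2 := Rmax_Cmod _). apply Rle_trans with (2 := Rmax_l _ _). simpl.
assert (Hc : cos_coef (scaled A (INR N) 0 cos) (Z.of_nat N) = PI * A).
{ rewrite <- (cos_coef_cos (Z.of_nat N) Hk 0 A). f_equal. apply functional_extensionality.
  intros x. unfold scaled. rewrite <- INR_IZR_INZ. ring. }
assert (Hs : sin_coef (scaled A (INR N) 0 sin) (Z.of_nat N) = PI * A).
{ rewrite <- (sin_coef_sin (Z.of_nat N) Hk 0 A). f_equal. apply functional_extensionality.
  intros x. unfold scaled. rewrite <- INR_IZR_INZ. ring. }
rewrite Hc, Hs. replace (/ (2 * PI) * (PI * A + PI * A)) with A by (field; lra).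
apply Rle_abs.
Qed.

End PlaneWave.

Lemma fourier_minus_mean (N : nat) (D D' : R) (f g : R -> C) :
  oscillating_profile N D f -> oscillating_profile N D' g ->
  fourier f 0 = 0 -> fourier g 0 = 0 -> Cmod (fourier (profile_minus f g) 0) = 0.
Proof.
intros Hf Hg H H'. rewrite (fourier_profile_minus N D D'), H, H' by assumption.
rewrite <- Cmod_0. f_equal. apply injective_projections; simpl; ring.
Qed.

Lemma NLS_ill_posed (s : R) : s < 0 -> ill_posed NLS s.
Proof.
intros Hs. apply (ill_posed_of_decoherence NLS s 17 1); try lra.
intros delta T Hdelta HT.
set (eta := Rmin 1 (delta / 16)).
assert (Heta : 0 < eta <= 1 /\ eta <= delta / 16).
{ unfold eta. split; [split|]; [apply Rmin_glb_lt; lra | apply Rmin_l | apply Rmin_r]. }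
assert (HetaT : 0 < eta * T / 2) by (apply Rdiv_lt_0_compat; [apply Rmult_lt_0_compat|]; lra).
destruct (Rpower_small2 (2 * s) (2 * s) (eta * T / 2) 1) as (N & HN & HNT & _); try lra.
assert (HN' : 0 < INR N) by now apply lt_0_INR.
assert (HX := Rpower_pos (INR N) s). set (X := Rpower (INR N) s) in *.
replace (2 * s) with (s + s) in HNT by ring. rewrite Rpower_plus in HNT. fold X in HNT.
set (A := / X).
assert (HA : 0 < A) by now apply Rinv_0_lt_compat.
assert (HAX : A * X = 1) by (unfold A; field; lra).
set (A' := (1 + eta) * A).
assert (HA' : 0 < A') by (apply Rmult_lt_0_compat; lra).
assert (Hosc := plane_wave_oscillating N A HN ltac:(lra)).
assert (Hosc' := plane_wave_oscillating N A' HN ltac:(lra)).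
exists N, (plane_wave N A), (plane_wave N A'), (- (INR N ^ 2 + A ^ 2) / INR N),
  (- (INR N ^ 2 + A' ^ 2) / INR N), A, A', (eta * A).
assert (HetaA : 0 <= eta * A) by nra.
fold X. split; [lra|]. split; [exact Hosc|]. split; [exact Hosc'|]. split; [|split; [|split; [|split; [|split; [|split; [|split]]]]]].
- split; [exact HN|].
  assert (Hdiff : forall S, oscillating N (eta * A) (scaled (eta * A) (INR N) 0 S) ->
    oscillating N (eta * A) (fun x => scaled A (INR N) 0 S x - scaled A' (INR N) 0 S x)).
  { intros S HS.
    assert (H := oscillating_minus N 0 (eta * A) (fun _ => 0) _ (oscillating_0 N 0 (Rle_refl 0)) HS).
    rewrite Rplus_0_l in H.
    replace (fun x => scaled A (INR N) 0 S x - scaled A' (INR N) 0 S x)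
      with (fun x => 0 - scaled (eta * A) (INR N) 0 S x); [exact H|].
    apply functional_extensionality. intros x. unfold scaled, A'. ring. }
  destruct (plane_wave_oscillating N (eta * A) HN HetaA) as (_ & HRe & HIm).
  split; [exact (Hdiff cos HRe) | exact (Hdiff sin HIm)].
- apply plane_wave_solution; lra || assumption.
- apply plane_wave_solution; lra || assumption.
- rewrite plane_wave_mean, Cmod_0 by (lra || assumption).
  replace (8 * A * X) with (8 * (A * X)) by ring. lra.
- rewrite plane_wave_mean, Cmod_0 by (lra || assumption).
  replace (8 * A' * X) with (8 * (1 + eta) * (A * X)) by (unfold A'; ring). rewrite HAX. lra.
- rewrite (fourier_minus_mean N A A') by (assumption || apply plane_wave_mean; lra || assumption).
  replace (8 * (eta * A) * X) with (8 * eta * (A * X)) by ring. rewrite HAX. lra.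
- assert (H := plane_wave_mode N A HN ltac:(lra)). rewrite <- HAX. apply Rmult_le_compat_r; lra.
- replace (- (INR N ^ 2 + A ^ 2) / INR N - - (INR N ^ 2 + A' ^ 2) / INR N)
    with ((A' ^ 2 - A ^ 2) / INR N) by (field; lra).
  assert (HAA : 2 * eta * A ^ 2 <= A' ^ 2 - A ^ 2) by (unfold A'; nra).
  assert (HA2 : 0 < A ^ 2) by (apply pow_lt; lra).
  rewrite Rabs_pos_eq by (apply Rmult_le_pos; [nra | left; now apply Rinv_0_lt_compat]).
  replace (INR N * ((A' ^ 2 - A ^ 2) / INR N)) with (A' ^ 2 - A ^ 2) by (field; lra).
  assert (H4 := PI_4).
  apply Rle_lt_trans with 4; [exact H4|].
  apply Rlt_le_trans with (2 * eta * A ^ 2 * T); [|apply Rmult_le_compat_r; lra].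
  assert (HX1 : A ^ 2 * (X * X) = 1) by (replace (A ^ 2 * (X * X)) with ((A * X) ^ 2) by ring; rewrite HAX; ring).
  nra.
Qed.

Lemma frequency_ge_1 (N : nat) : (0 < N)%nat -> 1 <= INR N.
Proof. intros HN. apply (le_INR 1). lia. Qed.

(** * Snoidal waves and mKdV *)

Section MKdVWave.

Context (N : nat) (k : R) (phi : R -> R).
Hypothesis HN : (0 < N)%nat.
Hypothesis Hk : 0 <= k.
Hypothesis Hk2 : 120 * k ^ 2 <= 1.
Hypothesis Hphi : amplitude (k ^ 2) phi.

Let B := mean_weight (k ^ 2).
Let HN' := frequency_ge_1 N HN.

Let Hm : 0 <= k ^ 2 <= 1 / 2.
Proof. assert (H := pow2_ge_0 k). lra. Qed.

Definition snoidal : R -> R := scaled (INR N * k * B) (INR N) 0 (sn phi).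

Let Hsn : smooth (sn phi).
Proof. exact (proj1 (smooth_sn (k ^ 2) phi Hm Hphi)). Qed.

Let snoidal_half_period x : snoidal (x + PI / INR N) = - snoidal x.
Proof.
unfold snoidal, scaled, sn.
replace (INR N * (x + PI / INR N)) with (INR N * x + PI) by (field; lra).
rewrite (proj1 (proj2 Hphi)), neg_sin. ring.
Qed.

Lemma snoidal_Derive2 (x : R) :
  Rabs (Derive_n snoidal 2 x + INR N ^ 3 * k * sin (INR N * x)) <= 30 * INR N ^ 3 * k ^ 3.
Proof.
unfold snoidal. rewrite Derive_n_scaled by (exact Hsn || lia).
replace (INR N * k * B * INR N ^ 2 * Derive_n (sn phi) 2 (INR N * x)
         + INR N ^ 3 * k * sin (INR N * x))
  with (INR N ^ 3 * k * (B * Derive_n (sn phi) 2 (INR N * x) + sin (INR N * x))) by ring.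
assert (H3 : 0 <= INR N ^ 3 * k) by (apply Rmult_le_pos; [apply pow_le; lra | exact Hk]).
rewrite Rabs_mult, (Rabs_pos_eq _ H3).
replace (30 * INR N ^ 3 * k ^ 3) with (INR N ^ 3 * k * (30 * k ^ 2)) by ring.
apply Rmult_le_compat_l; [exact H3|]. now apply Derive2_sn_approx.
Qed.

Lemma snoidal_oscillating : oscillating N (2 * INR N * k) snoidal.
Proof.
split; [now apply smooth_scaled | split].
- intros x. replace (x + 2 * PI / INR N) with (x + PI / INR N + PI / INR N) by (field; lra).
  rewrite !snoidal_half_period. ring.
- intros x. assert (H := snoidal_Derive2 x). apply Rabs_le_between in H.
  assert (Hs := SIN_bound (INR N * x)).
  assert (H3 : 0 <= INR N ^ 3 * k) by (apply Rmult_le_pos; [apply pow_le; lra | exact Hk]).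
  assert (H4 : 30 * INR N ^ 3 * k ^ 3 <= INR N ^ 3 * k).
  { replace (30 * INR N ^ 3 * k ^ 3) with (INR N ^ 3 * k * (30 * k ^ 2)) by ring. nra. }
  apply Rabs_le. replace (2 * INR N * k * INR N ^ 2) with (2 * (INR N ^ 3 * k)) by ring.
  nra.
Qed.

Lemma snoidal_solution :
  solution_map mKdV (real_profile snoidal)
    (wave (- (INR N ^ 2 * B ^ 2 * (1 + k ^ 2))) (real_profile snoidal)).
Proof.
apply mKdV_wave.
- apply snoidal_oscillating.
- apply (oscillating_period N _ _ HN snoidal_oscillating).
- intros x. change (Derive snoidal x) with (Derive_n snoidal 1 x).
  unfold snoidal. rewrite !Derive_n_scaled by (exact Hsn || lia).
  rewrite (Derive3_sn (k ^ 2) phi Hm Hphi). fold B. unfold scaled. ring.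
Qed.

Lemma snoidal_mean : fourier (real_profile snoidal) 0 = 0.
Proof.
assert (HD : 0 <= 2 * INR N * k) by (apply Rmult_le_pos; lra).
rewrite (fourier_real_profile N _ _ _ HN HD snoidal_oscillating).
assert (Hc : forall x, continuous snoidal x)
  by (intros x; apply smooth_continuous, snoidal_oscillating).
rewrite sin_coef_0 by exact Hc.
rewrite (cos_coef_antiperiodic snoidal (PI / INR N) Hc).
- apply injective_projections; simpl; ring.
- apply (oscillating_period N _ _ HN snoidal_oscillating).
- exact snoidal_half_period.
Qed.

Lemma snoidal_mode : INR N * k / 4 <= Cmod (fourier (real_profile snoidal) (Z.of_nat N)).
Proof.
assert (HNk : 0 <= INR N * k) by (apply Rmult_le_pos; lra).
assert (H := fourier_mode_ge N (2 * INR N * k) 0 (INR N * k) (INR N * k * (10 * k ^ 2)) snoidal HN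
  ltac:(lra) snoidal_oscillating HNk).
apply Rle_trans with (INR N * k / 2 - INR N * k * (10 * k ^ 2)); [nra|].
apply H. left. intros x. unfold snoidal, scaled.
replace (INR N * k * B * sn phi (INR N * x) - 0 - (0 + INR N * k * sin (INR N * x)))
  with (INR N * k * (B * sn phi (INR N * x) - sin (INR N * x))) by ring.
rewrite Rabs_mult, (Rabs_pos_eq _ HNk). apply Rmult_le_compat_l; [exact HNk|].
now apply sn_approx.
Qed.

End MKdVWave.

Lemma snoidal_minus_oscillating (N : nat) (k k' : R) (phi phi' : R -> R) :
  (0 < N)%nat -> 0 <= k -> k <= k' -> 120 * k' ^ 2 <= 1 ->
  amplitude (k ^ 2) phi -> amplitude (k' ^ 2) phi' ->
  oscillating N (INR N * (k' - k) + 60 * INR N * k' ^ 3)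
    (fun x => snoidal N k phi x - snoidal N k' phi' x).
Proof.
intros HN Hk Hkk Hk' Hphi Hphi'.
assert (Hkk2 : k ^ 2 <= k' ^ 2) by (apply pow_incr; lra).
destruct (snoidal_oscillating N k phi HN Hk ltac:(lra) Hphi) as (Hs & Hper & _).
destruct (snoidal_oscillating N k' phi' HN ltac:(lra) Hk' Hphi') as (Hs' & Hper' & _).
split; [now apply smooth_minus | split].
- intros x. now rewrite Hper, Hper'.
- intros x. rewrite Derive_n_smooth_minus by assumption.
  assert (H := snoidal_Derive2 N k phi HN Hk ltac:(lra) Hphi x).
  assert (H' := snoidal_Derive2 N k' phi' HN ltac:(lra) Hk' Hphi' x).
  apply Rabs_le_between in H. apply Rabs_le_between in H'.
  assert (HN3 : 0 <= INR N ^ 3) by apply pow_le, pos_INR.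
  assert (Hk3 : k ^ 3 <= k' ^ 3) by (apply pow_incr; lra).
  assert (Hsin := SIN_bound (INR N * x)).
  assert (Hmid : - (INR N ^ 3 * (k' - k)) <= INR N ^ 3 * (k' - k) * sin (INR N * x)
                 <= INR N ^ 3 * (k' - k)).
  { assert (0 <= INR N ^ 3 * (k' - k)) by (apply Rmult_le_pos; lra). nra. }
  assert (HNk3 : INR N ^ 3 * k ^ 3 <= INR N ^ 3 * k' ^ 3) by now apply Rmult_le_compat_l.
  apply Rabs_le.
  replace ((INR N * (k' - k) + 60 * INR N * k' ^ 3) * INR N ^ 2)
    with (INR N ^ 3 * (k' - k) + 60 * (INR N ^ 3 * k' ^ 3)) by ring.
  nra.
Qed.

Lemma mKdV_ill_posed (s : R) : -1 < s < 1 / 2 -> ill_posed mKdV s.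
Proof.
intros Hs. apply (ill_posed_of_decoherence mKdV s 33 (1 / 4)); try lra.
intros delta T Hdelta HT.
set (eta := Rmin 1 (delta / 32)).
assert (Heta : 0 < eta <= 1 /\ eta <= delta / 32).
{ unfold eta. split; [split|]; [apply Rmin_glb_lt; lra | apply Rmin_l | apply Rmin_r]. }
assert (HetaT : 0 < eta * T / 2) by (apply Rdiv_lt_0_compat; [apply Rmult_lt_0_compat|]; lra).
set (small := Rmin (1 / 480) (delta / 10000)).
assert (Hsmall : 0 < small /\ small <= 1 / 480 /\ small <= delta / 10000).
{ unfold small. split; [|split]; [apply Rmin_glb_lt; lra | apply Rmin_l | apply Rmin_r]. }
destruct (Rpower_small2 (2 * s - 1) (2 * (- 1 - s)) (eta * T / 2) small) as (N & HN & HNT & HNs); try lra.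
assert (HN' := frequency_ge_1 N HN).
assert (HX := Rpower_pos (INR N) s). set (X := Rpower (INR N) s) in *.
set (k := / (INR N * X)).
assert (HNX : 0 < INR N * X) by (apply Rmult_lt_0_compat; lra).
assert (Hk : 0 < k) by now apply Rinv_0_lt_compat.
assert (HkX : INR N * k * X = 1) by (unfold k; field; lra).
assert (Hk2 : k ^ 2 < small).
{ replace (k ^ 2) with (Rpower (INR N) (2 * (- 1 - s))); [exact HNs|].
  replace (2 * (- 1 - s)) with (- (1 + s) + - (1 + s)) by ring.
  rewrite Rpower_plus, Rpower_Ropp, Rpower_plus, Rpower_1 by lra.
  fold X. unfold k. ring. }
assert (Hspeed : 1 < INR N ^ 3 * k ^ 2 * (eta * T / 2)).
{ assert (Heq : INR N ^ 3 * k ^ 2 * Rpower (INR N) (2 * s - 1) = 1).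
  { replace (2 * s - 1) with (s + s + - (1)) by ring.
    rewrite !Rpower_plus, Rpower_Ropp, Rpower_1 by lra. fold X.
    unfold k. field. lra. }
  assert (H3 : 0 < INR N ^ 3 * k ^ 2) by (apply Rmult_lt_0_compat; apply pow_lt; lra).
  rewrite <- Heq. now apply Rmult_lt_compat_l. }
set (k' := (1 + eta) * k).
assert (Hkk : k <= k' <= 2 * k) by (unfold k'; nra).
assert (Hk'2 : k' ^ 2 <= 4 * k ^ 2) by nra.
destruct (amplitude_exists (k ^ 2)) as (phi & Hphi); [assert (H := pow2_ge_0 k); lra|].
destruct (amplitude_exists (k' ^ 2)) as (phi' & Hphi'); [assert (H := pow2_ge_0 k'); lra|].
assert (Hosc := snoidal_oscillating N k phi HN ltac:(lra) ltac:(lra) Hphi).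
assert (Hosc' := snoidal_oscillating N k' phi' HN ltac:(lra) ltac:(lra) Hphi').
set (D := 2 * INR N * k) in *. set (D' := 2 * INR N * k') in *.
set (D'' := INR N * (k' - k) + 60 * INR N * k' ^ 3).
assert (HD : 0 <= D) by (unfold D; repeat apply Rmult_le_pos; lra).
assert (HD' : 0 <= D') by (unfold D'; repeat apply Rmult_le_pos; lra).
assert (HD'' : 0 <= D'').
{ apply Rplus_le_le_0_compat; repeat apply Rmult_le_pos; lra. }
assert (Hprof := oscillating_real_profile N D _ HN HD Hosc).
assert (Hprof' := oscillating_real_profile N D' _ HN HD' Hosc').
exists N, (real_profile (snoidal N k phi)), (real_profile (snoidal N k' phi')),
  (- (INR N ^ 2 * mean_weight (k ^ 2) ^ 2 * (1 + k ^ 2))),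
  (- (INR N ^ 2 * mean_weight (k' ^ 2) ^ 2 * (1 + k' ^ 2))), D, D', D''.
fold X. split; [lra|]. split; [exact Hprof|]. split; [exact Hprof'|].
split; [|split; [|split; [|split; [|split; [|split; [|split]]]]]].
- split; [exact HN | split].
  + apply (snoidal_minus_oscillating N k k' phi phi'); assumption || lra.
  + replace (fun x => Im (profile_minus (real_profile (snoidal N k phi)) (real_profile (snoidal N k' phi')) x))
      with (fun _ : R => 0); [now apply oscillating_0|].
    apply functional_extensionality. intros x. simpl. ring.
- apply snoidal_solution; assumption || lra.
- apply snoidal_solution; assumption || lra.
- rewrite snoidal_mean, Cmod_0 by (assumption || lra).
  replace (8 * D * X) with (16 * (INR N * k * X)) by (unfold D; ring). lra.
- rewrite snoidal_mean, Cmod_0 by (assumption || lra).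
  replace (8 * D' * X) with (16 * (1 + eta) * (INR N * k * X)) by (unfold D', k'; ring).
  rewrite HkX. lra.
- rewrite (fourier_minus_mean N D D') by (assumption || apply snoidal_mean; assumption || lra).
  assert (HD''X : D'' * X = eta + 60 * (1 + eta) * k' ^ 2).
  { transitivity (eta * (INR N * k * X) + 60 * (1 + eta) * k' ^ 2 * (INR N * k * X)).
    - unfold D'', k'. ring.
    - rewrite HkX. ring. }
  replace (8 * D'' * X) with (8 * (D'' * X)) by ring. rewrite HD''X.
  assert (H := pow2_ge_0 k'). nra.
- assert (H := snoidal_mode N k phi HN ltac:(lra) ltac:(lra) Hphi).
  replace (1 / 4) with (INR N * k / 4 * X) by lra. apply Rmult_le_compat_r; lra.
- set (B := mean_weight (k ^ 2)). set (B' := mean_weight (k' ^ 2)).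
  assert (Hk0 := pow2_ge_0 k).
  assert (Hkk2 : k ^ 2 <= k' ^ 2) by (apply pow_incr; lra).
  assert (HB : 1 <= B) by (apply mean_weight_bounds; lra).
  assert (HBB : B <= B') by (apply mean_weight_monotone; lra).
  assert (HB2 : 1 <= B ^ 2 /\ B ^ 2 <= B' ^ 2) by (split; [nra | apply pow_incr; lra]).
  assert (Hgap : 2 * eta * k ^ 2 <= B' ^ 2 * (1 + k' ^ 2) - B ^ 2 * (1 + k ^ 2)).
  { assert (H : 2 * eta * k ^ 2 <= k' ^ 2 - k ^ 2) by (unfold k'; nra). nra. }
  replace (- (INR N ^ 2 * B ^ 2 * (1 + k ^ 2)) - - (INR N ^ 2 * B' ^ 2 * (1 + k' ^ 2)))
    with (INR N ^ 2 * (B' ^ 2 * (1 + k' ^ 2) - B ^ 2 * (1 + k ^ 2))) by ring.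
  assert (HN2 : 0 < INR N ^ 2) by (apply pow_lt; lra).
  assert (H4 := PI_4).
  apply Rle_lt_trans with 4; [exact H4|].
  apply Rlt_le_trans with (INR N * (INR N ^ 2 * (2 * eta * k ^ 2)) * T).
  + replace (INR N * (INR N ^ 2 * (2 * eta * k ^ 2)) * T)
      with (4 * (INR N ^ 3 * k ^ 2 * (eta * T / 2))) by field. lra.
  + apply Rmult_le_compat_r; [lra|]. apply Rmult_le_compat_l; [lra|].
    apply Rle_trans with (2 := Rle_abs _). apply Rmult_le_compat_l; lra.
Qed.

(** * Cnoidal waves and KdV *)

Lemma fourier_mean_const (a : R) : fourier (real_profile (fun _ => a)) 0 = RtoC a.
Proof.
assert (Ha : oscillating 1 0 (fun _ => a)).
{ split; [apply smooth_const | split; [reflexivity|]]. intros x.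
  rewrite Derive_n_const, Rabs_R0. lra. }
rewrite (fourier_real_profile 1 0 _ 0 ltac:(lia) (Rle_refl 0) Ha).
rewrite sin_coef_0 by (intros x; apply continuous_const).
assert (Hc : cos_coef (fun _ => a) 0 = 2 * PI * a).
{ unfold cos_coef. rewrite (RInt_of_derive (fun x => a * x)).
  - ring.
  - intros x. rewrite Rmult_0_l, cos_0. auto_derive; [exact I | ring].
  - intros x. apply (continuous_mult (K := R_AbsRing)); [apply continuous_const | apply continuous_cos_linear]. }
assert (HPI := PI_RGT_0). rewrite Hc. apply injective_projections; simpl; [field; lra | ring].
Qed.

Section KdVWave.

Context (M : nat) (m : R) (phi : R -> R).
Hypothesis HM : (0 < M)%nat.
Hypothesis Hm : 0 <= m <= 1 / 176.
Hypothesis Hphi : amplitude m phi.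

Let B := mean_weight m.
Let HM' := frequency_ge_1 M HM.

Let Hm' : 0 <= m <= 1 / 2.
Proof. lra. Qed.

Definition cnoidal (b : R) : R -> R := scaled (2 * m * B ^ 2 * INR M ^ 2) (INR M) b (sn2 phi).

Let Hsn2 : smooth (sn2 phi).
Proof. exact (proj2 (smooth_sn m phi Hm' Hphi)). Qed.

Let N := (2 * M)%nat.

Let INR_N : INR N = 2 * INR M.
Proof. unfold N. now rewrite mult_INR. Qed.

Let HN : (0 < N)%nat.
Proof. unfold N. lia. Qed.

Lemma cnoidal_oscillating (b : R) : oscillating N (32 * m * INR M ^ 2) (cnoidal b).
Proof.
split; [now apply smooth_scaled | split].
- intros x. rewrite INR_N. unfold cnoidal, scaled, sn2.
  replace (INR M * (x + 2 * PI / (2 * INR M))) with (INR M * x + PI) by (field; lra).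
  now rewrite (proj1 (proj2 Hphi)), sin_sqr_plus_PI.
- intros x. unfold cnoidal. rewrite Derive_n_scaled by (exact Hsn2 || lia).
  rewrite (Derive2_sn2 m phi Hm' Hphi), INR_N. fold B. unfold sn2.
  assert (Hs := sin_sqr_bounds (phi (INR M * x))). set (S := sin (phi (INR M * x)) ^ 2) in *.
  assert (HB : 1 <= B <= 1 + 2 * m) by now apply mean_weight_bounds.
  assert (HB4 : 0 <= B ^ 4 <= 2).
  { split; [apply pow_le; lra|]. apply Rle_trans with ((89 / 88) ^ 4); [apply pow_incr; lra | lra]. }
  set (E := 1 - 2 * (1 + m) * S + 3 * m * S ^ 2).
  assert (HE : Rabs E <= 8) by (apply Rabs_le; unfold E; nra).
  assert (Hpos : 0 <= 4 * m * INR M ^ 4) by (repeat apply Rmult_le_pos; try apply pow_le; lra).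
  replace (2 * m * B ^ 2 * INR M ^ 2 * INR M ^ 2 * (2 * B ^ 2 * E))
    with (4 * m * INR M ^ 4 * (B ^ 4 * E)) by ring.
  replace (32 * m * INR M ^ 2 * (2 * INR M) ^ 2) with (4 * m * INR M ^ 4 * 32) by ring.
  rewrite Rabs_mult, (Rabs_pos_eq _ Hpos). apply Rmult_le_compat_l; [exact Hpos|].
  rewrite Rabs_mult, (Rabs_pos_eq (B ^ 4)) by lra. assert (H := Rabs_pos E). nra.
Qed.

Lemma cnoidal_solution (b : R) :
  solution_map KdV (real_profile (cnoidal b))
    (wave (- (4 * INR M ^ 2 * B ^ 2 * (1 + m)) + 6 * b) (real_profile (cnoidal b))).
Proof.
apply KdV_wave.
- apply cnoidal_oscillating.
- apply (oscillating_period N _ _ HN (cnoidal_oscillating b)).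
- intros x. change (Derive (cnoidal b) x) with (Derive_n (cnoidal b) 1 x).
  unfold cnoidal. rewrite !Derive_n_scaled by (exact Hsn2 || lia).
  rewrite (Derive3_sn2 m phi Hm' Hphi). fold B. unfold scaled. ring.
Qed.

Lemma cnoidal_mode (b : R) :
  m * INR M ^ 2 / 4 <= Cmod (fourier (real_profile (cnoidal b)) (Z.of_nat N)).
Proof.
assert (HmM : 0 <= m * INR M ^ 2) by (apply Rmult_le_pos; [lra | apply pow2_ge_0]).
assert (H := fourier_mode_ge N (32 * m * INR M ^ 2) (m * INR M ^ 2 - b) (m * INR M ^ 2)
  (m * INR M ^ 2 * (44 * m)) (cnoidal b) HN ltac:(lra) (cnoidal_oscillating b) HmM).
apply Rle_trans with (m * INR M ^ 2 / 2 - m * INR M ^ 2 * (44 * m)); [nra|].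
apply H. right. intros x. unfold cnoidal, scaled. rewrite INR_N, (Rmult_assoc 2 (INR M) x).
replace (2 * m * B ^ 2 * INR M ^ 2 * sn2 phi (INR M * x) - b
         - (m * INR M ^ 2 - b + - (m * INR M ^ 2) * cos (2 * (INR M * x))))
  with (m * INR M ^ 2 * (2 * B ^ 2 * sn2 phi (INR M * x) - (1 - cos (2 * (INR M * x))))) by ring.
rewrite Rabs_mult, (Rabs_pos_eq _ HmM). apply Rmult_le_compat_l; [exact HmM|].
now apply sn2_approx.
Qed.

Lemma cnoidal_mean : exists b0, forall mu,
  fourier (real_profile (cnoidal (b0 - mu))) 0 = RtoC mu.
Proof.
assert (HD : 0 <= 32 * m * INR M ^ 2) by (apply Rmult_le_pos; [lra | apply pow2_ge_0]).
exists (/ (2 * PI) * cos_coef (cnoidal 0) 0). intros mu.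
set (b := / (2 * PI) * cos_coef (cnoidal 0) 0 - mu).
assert (Hosc0 := cnoidal_oscillating 0).
assert (Hb : oscillating N 0 (fun _ => b)).
{ split; [apply smooth_const | split; [reflexivity|]]. intros x.
  rewrite Derive_n_const, Rabs_R0. lra. }
replace (real_profile (cnoidal b))
  with (profile_minus (real_profile (cnoidal 0)) (real_profile (fun _ => b))).
2:{ apply functional_extensionality. intros x. unfold profile_minus, real_profile, cnoidal, scaled.
    apply injective_projections; simpl; ring. }
rewrite (fourier_profile_minus N (32 * m * INR M ^ 2) 0)
  by (apply oscillating_real_profile; assumption || lra).
rewrite fourier_mean_const, (fourier_real_profile N _ _ _ HN HD Hosc0).
rewrite sin_coef_0 by (intros x; apply smooth_continuous, Hosc0).
unfold b. apply injective_projections; simpl; ring.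
Qed.

End KdVWave.

Lemma KdV_ill_posed (s : R) : -2 < s < - (1 / 2) -> ill_posed KdV s.
Proof.
intros Hs. apply (ill_posed_of_decoherence KdV s 258 (1 / 4)); try lra.
intros delta T Hdelta HT.
set (lim := Rmin 1 delta * T).
assert (Hlim : 0 < lim) by (apply Rmult_lt_0_compat; [apply Rmin_glb_lt; lra | exact HT]).
set (P2 := Rpower 2 s). assert (HP2 : 0 < P2) by apply Rpower_pos.
destruct (Rpower_small2 (- (1)) (- (2 + s)) lim (P2 / 176)) as (M & HM & HMT & HMs); try lra.
assert (HM' := frequency_ge_1 M HM).
set (N := (2 * M)%nat).
assert (HN : (0 < N)%nat) by (unfold N; lia).
assert (INR_N : INR N = 2 * INR M) by (unfold N; now rewrite mult_INR).
assert (HX := Rpower_pos (INR N) s). set (X := Rpower (INR N) s) in *.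
assert (HXeq : X = P2 * Rpower (INR M) s).
{ unfold X, P2. rewrite INR_N. symmetry. apply Rpower_mult_distr; lra. }
assert (HRM := Rpower_pos (INR M) s).
set (m := / (INR M ^ 2 * X)).
assert (HM2 : 0 < INR M ^ 2) by (apply pow_lt; lra).
assert (HMX : 0 < INR M ^ 2 * X) by now apply Rmult_lt_0_compat.
assert (Hm0 : 0 < m) by now apply Rinv_0_lt_compat.
assert (HmX : m * INR M ^ 2 * X = 1) by (unfold m; field; lra).
assert (Hm : 0 <= m <= 1 / 176).
{ split; [lra|].
  assert (Heq : m * P2 = Rpower (INR M) (- (2 + s))).
  { rewrite Rpower_Ropp, Rpower_plus. replace (Rpower (INR M) 2) with (INR M ^ 2).
    - unfold m. rewrite HXeq. field. repeat split; lra.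
    - replace 2 with (1 + 1) by ring. rewrite Rpower_plus, Rpower_1 by lra. ring. }
  rewrite <- Heq in HMs. nra. }
assert (HMT' : / INR M < lim) by (rewrite Rpower_Ropp, Rpower_1 in HMT by lra; exact HMT).
set (mu := / (INR N * T)).
assert (HNT : 0 < INR N * T) by (apply Rmult_lt_0_compat; lra).
assert (Hmu0 : 0 < mu) by now apply Rinv_0_lt_compat.
assert (Hmu : mu < Rmin 1 delta).
{ assert (H : mu * T = / INR M / 2) by (unfold mu; rewrite INR_N; field; lra).
  assert (H' : 0 < / INR M) by (apply Rinv_0_lt_compat; lra).
  apply (Rmult_lt_reg_r T); [exact HT|]. fold lim. lra. }
assert (Hmu1 := Rmin_l 1 delta). assert (Hmu2 := Rmin_r 1 delta).
destruct (amplitude_exists m) as (phi & Hphi); [lra|].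
destruct (cnoidal_mean M m phi HM Hm Hphi) as (b0 & Hmean).
set (D := 32 * m * INR M ^ 2).
assert (HD : 0 <= D) by (unfold D; repeat apply Rmult_le_pos; lra).
assert (HDX : 8 * D * X = 256).
{ replace (8 * D * X) with (256 * (m * INR M ^ 2 * X)) by (unfold D; ring). lra. }
assert (Hprof : forall b, oscillating_profile N D (real_profile (cnoidal M m phi b))).
{ intros b. apply oscillating_real_profile; [exact HN | exact HD | now apply cnoidal_oscillating]. }
exists N, (real_profile (cnoidal M m phi (b0 - 0))), (real_profile (cnoidal M m phi (b0 - mu))),
  (- (4 * INR M ^ 2 * mean_weight m ^ 2 * (1 + m)) + 6 * (b0 - 0)),
  (- (4 * INR M ^ 2 * mean_weight m ^ 2 * (1 + m)) + 6 * (b0 - mu)), D, D, 0.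
fold X. split; [lra|]. split; [apply Hprof|]. split; [apply Hprof|].
split; [|split; [|split; [|split; [|split; [|split; [|split]]]]]].
- replace (profile_minus _ _) with (real_profile (fun _ : R => - mu)).
  + apply oscillating_real_profile; [exact HN | lra |].
    split; [apply smooth_const | split; [reflexivity|]].
    intros x. rewrite Derive_n_const, Rabs_R0. lra.
  + apply functional_extensionality. intros x.
    unfold profile_minus, real_profile, cnoidal, scaled. apply injective_projections; simpl; ring.
- now apply cnoidal_solution.
- now apply cnoidal_solution.
- rewrite Hmean, Cmod_R, Rabs_R0. lra.
- rewrite Hmean, Cmod_R, Rabs_pos_eq by lra. lra.
- rewrite (fourier_profile_minus N D D) by apply Hprof. rewrite !Hmean, <- RtoC_minus, Cmod_R.
  rewrite Rminus_0_l, Rabs_Ropp, Rabs_pos_eq by lra. lra.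
- assert (H := cnoidal_mode M m phi HM Hm Hphi (b0 - 0)). fold N in H.
  replace (1 / 4) with (m * INR M ^ 2 / 4 * X) by lra. apply Rmult_le_compat_r; lra.
- replace (_ - _) with (6 * mu) by ring. rewrite Rabs_pos_eq by lra.
  replace (INR N * (6 * mu) * T) with 6 by (unfold mu; field; lra).
  assert (H4 := PI_4). lra.
Qed.

Theorem theorem8 :
  (forall s : R, s < 0 -> ill_posed NLS s) /\
  (forall s : R, -1 < s < 1 / 2 -> ill_posed mKdV s) /\
  (forall s : R, -2 < s < - (1 / 2) -> ill_posed KdV s).
Proof.
split; [exact NLS_ill_posed | split; [exact mKdV_ill_posed | exact KdV_ill_posed]].
Qed.
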